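(* Under the standing assumptions below, the process $(\zeta_t,t\ge0)$ is an $\mathbb F^\zeta$-Markov process: for all $t,h\ge0$ and every bounded measurable $f:\mathbb R\to\mathbb R$, $$\mathbb E[f(\zeta_{t+h})\mid\mathcal F^\zeta_t]=\mathbb E[f(\zeta_{t+h})\mid\zeta_t]\quad\mathbb P\text{-a.s.}$$
   Context: $\gamma$ a standard gamma process (driftless subordinator, $\gamma_0=0$, càdlàg, $\mathbb E[e^{-\lambda\gamma_t}]=(1+\lambda)^{-t}$) on a complete probability space $(\Omega,\mathcal F,\mathbb P)$; $\tau:\Omega\to(0,\infty)$ a random variable independent of $\gamma$; $\zeta_t=\gamma_{t\wedge\tau}/\gamma_\tau$, $t\ge0$; $\mathcal F^\zeta_t=\sigma(\zeta_s,s\le t)$. *)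

(* Defs.v *)
From HB Require Import structures.
From mathcomp Require Import all_boot all_order all_algebra.
From mathcomp Require Import all_classical all_reals all_analysis.
Set Implicit Arguments. Unset Strict Implicit. Unset Printing Implicit Defensive.
Import Order.TTheory GRing.Theory Num.Theory.
Import numFieldNormedType.Exports.
Local Open Scope classical_set_scope.
Local Open Scope ring_scope.

Section Defs.
Context {d : measure_display} {T : measurableType d} {R : realType}.

Definition gen_sigma {I : Type} (J : set I) (X : I -> T -> R) : set (set T) :=
  <<s [set A | exists i, J i /\ exists B : set R, measurable B /\ A = X i @^-1` B] >>.

Definition indep_sigma (P : probability T R) (F G : set (set T)) : Prop :=
  forall A B, F A -> G B -> P (A `&` B) = (P A * P B)%E.

Definition is_cond_exp (P : probability T R) (G : set (set T)) (X Y : T -> R) : Prop :=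
  [/\ forall B : set R, measurable B -> G (Y @^-1` B),
      P.-integrable setT (EFin \o Y) &
      forall A, G A -> (\int[P]_(w in A) (Y w)%:E = \int[P]_(w in A) (X w)%:E)%E].

Definition standard_gamma_process (P : probability T R) (g : R -> T -> R) : Prop :=
  (forall t, 0 <= t -> measurable_fun setT (g t)) /\
      (forall w, g 0 w = 0) /\
      (forall w s t, 0 <= s -> s <= t -> g s w <= g t w) /\
      (forall w t, 0 <= t -> ((fun x => g x w) @ at_right t --> g t w)) /\
      (forall w t, 0 < t -> cvg ((fun x => g x w) @ at_left t)) /\
      (forall (n : nat) (ts : nat -> R) (Bs : nat -> set R),
         0 <= ts 0%N -> (forall i, ts i <= ts i.+1) -> (forall i, measurable (Bs i)) ->
         P (\bigcap_(i in `I_n) [set w | Bs i (g (ts i.+1) w - g (ts i) w)%R]) =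
         (\prod_(i < n) P [set w | Bs i (g (ts i.+1) w - g (ts i) w)%R])%E) /\
      (forall s t lam, 0 <= s -> s <= t -> 0 <= lam ->
         (\int[P]_w (expR (- (lam * (g t w - g s w))))%:E = ((1 + lam) `^ (- (t - s)))%:E)%E).

End Defs.

(* Main.v *)
(* For [c >= 0], tilting the law of the gamma process by [exp (- c g_t)] amounts
   to multiplying [(g_s)_(s <= t)] by [(1 + c)^-1]: both laws have the same
   Laplace functional. Ratios [g_s / g_t] do not see this factor, so they are
   independent of [g_t], and more generally of [tau] and of [(g_u)_(u >= t)].
   On [t < tau] we have [zeta_s = (g_s / g_t) zeta_t] for [s <= t], while
   [zeta_t] and [zeta_(t+h)] only depend on the future variables; hence the past
   of [zeta] carries no information on [zeta_(t+h)] beyond [zeta_t]. On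
   [tau <= t] both [zeta_t] and [zeta_(t+h)] are equal to [1], and the two events
   are distinguished, up to a null set, by whether [zeta_t = 1]. *)
Require Import Defs.
From HB Require Import structures.
From mathcomp Require Import all_boot all_order all_algebra.
From mathcomp Require Import all_classical all_reals all_analysis.
From mathcomp Require Import measurable_realfun.
From mathcomp Require Import ring lra.
Import Order.TTheory GRing.Theory Num.Theory.
Import numFieldNormedType.Exports.
Local Open Scope classical_set_scope.
Local Open Scope ring_scope.

(** The law of the gamma increments is given only through Laplace transforms, so identities of laws
    are checked on exponentials with nonnegative coefficients and then extended:
    [(1 - expR (- a F)) ^+ N] expands into such exponentials and tends to the indicator of [x < F]
    for suitable [a] and [N]. The tilting identity rests on [1 + c + m = (1 + m) (1 + c / (1 + m))]:
    a total coefficient [m] carried by times from [t] on adds to every earlier coefficient and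
    divides out as a scaling. The event [t < tau] lies in the sigma-algebra of [zeta t] only up to a
    null set, and the sigma-algebras of the statement are not completed. No membership is therefore
    claimed: [Y] is chosen as [phi (zeta t)], a conditional expectation given [zeta t] alone, and
    each test integral over a past event is split along [t < tau], the two pieces being compared
    separately. *)

(** * Integrals over events and comparison on a pi-system *)

Lemma bounded_integrable {d : measure_display} {T : measurableType d}
    {R : realType} (P : probability T R) (f : T -> R) (M : R) :
  measurable_fun setT f -> (forall x, `|f x| <= M) ->
  P.-integrable setT (EFin \o f).
Proof.
move=> mf fM; apply: measurable_bounded_integrable => //.
  by rewrite [X in (X < _)%E]probability_setT ltry.
exists M; split; first exact: num_real.
by move=> y My x _; apply: (le_trans (fM x)); exact: ltW.
Qed.

Lemma integral_setC_eq {d : measure_display} {T : measurableType d}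
    {R : realType} (P : probability T R) (f : T -> R) (A : set T) :
  measurable A -> P.-integrable setT (EFin \o f) ->
  (\int[P]_(w in ~` A) (f w)%:E =
   \int[P]_w (f w)%:E - \int[P]_(w in A) (f w)%:E)%E.
Proof.
move=> mA fi; rewrite -(setUv A) integral_setU//.
- rewrite addeAC subee ?add0e// integrable_fin_num//.
  exact: integrableS fi.
- exact: measurableC.
- by rewrite setUv; apply/(measurable_int P).
- by apply/disj_setPS; rewrite setICr.
Qed.

(** Two finite signed measures, [f] pushed along [p] and [g] pushed along [q], are compared on a
    pi-system. [O] carries no measurable structure, so measurability of the preimages goes through
    the induction; the equality of total masses serves the complement step. *)
Lemma dynkin_integral_eq {d : measure_display} {T : measurableType d}
    {R : realType} (P : probability T R) (O : Type) (p q : T -> O)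
    (G : set (set O)) (f g : T -> R) :
  setI_closed G ->
  (forall A, G A -> measurable (p @^-1` A) /\ measurable (q @^-1` A)) ->
  P.-integrable setT (EFin \o f) -> P.-integrable setT (EFin \o g) ->
  (\int[P]_w (f w)%:E = \int[P]_w (g w)%:E)%E ->
  (forall A, G A ->
    (\int[P]_(w in p @^-1` A) (f w)%:E = \int[P]_(w in q @^-1` A) (g w)%:E)%E) ->
  forall A, <<s G >> A -> [/\ measurable (p @^-1` A), measurable (q @^-1` A) &
    (\int[P]_(w in p @^-1` A) (f w)%:E = \int[P]_(w in q @^-1` A) (g w)%:E)%E].
Proof.
move=> GI mG fi gi fg0 fgG A; rewrite -setI_closed_g_dynkin_g_sigma_algebra//.
pose H := [set A : set O | [/\ measurable (p @^-1` A), measurable (q @^-1` A) &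
  (\int[P]_(w in p @^-1` A) (f w)%:E = \int[P]_(w in q @^-1` A) (g w)%:E)%E]].
suff GH : <<d G >> `<=` H by move=> /GH.
apply: smallest_sub => [|B GB]; last first.
  by have [? ?] := mG _ GB; split => //; exact: fgG.
split.
- by split; rewrite ?preimage_setT.
- move=> B [mp mq e]; split.
  + exact: measurableC.
  + exact: measurableC.
  + by rewrite -(preimage_setC p) -(preimage_setC q) !integral_setC_eq// fg0 e.
- move=> F tF HF; rewrite /H /=.
  have pB (r : T -> O) : r @^-1` (\bigcup_k F k) = \bigcup_k (r @^-1` F k).
    exact: preimage_bigcup.
  rewrite (pB p) (pB q); split.
  + by apply: bigcupT_measurable => n; case: (HF n).
  + by apply: bigcupT_measurable => n; case: (HF n).
  + have tp (r : T -> O) : trivIset setT (fun n => r @^-1` F n).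
      by move=> i j _ _ [w [/= Fi Fj]]; apply: (tF i j I I); exists (r w).
    have mp n : measurable (p @^-1` F n) by case: (HF n).
    have mq n : measurable (q @^-1` F n) by case: (HF n).
    rewrite !integral_bigcup//.
    * by apply: eq_eseriesr => n _; case: (HF n).
    * apply: integrableS gi => //; exact: bigcupT_measurable.
    * apply: integrableS fi => //; exact: bigcupT_measurable.
Qed.

(** * Indicators of half-lines as limits of powers of [1 - expR (- a z)] *)

Lemma onem_exp_ge (R : realType) (q : R) (N : nat) :
  0 <= q <= 1 -> 1 - N%:R * q <= (1 - q) ^+ N.
Proof.
move=> /andP[q0 q1]; elim: N => [|N IH]; first by rewrite mul0r subr0 expr0.
have q1' : 0 <= 1 - q by lra.
rewrite exprS; have := ler_wpM2l q1' IH; apply: le_trans.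
have : 0 <= N%:R * q ^+ 2 by rewrite mulr_ge0// sqr_ge0.
rewrite -natr1; nra.
Qed.

Lemma onem_exp_le (R : realType) (q : R) (N : nat) :
  0 <= q <= 1 -> (1 - q) ^+ N * (1 + N%:R * q) <= 1.
Proof.
move=> /andP[q0 q1]; have q1' : 0 <= 1 - q by lra.
elim: N => [|N IH]; first by rewrite mul0r addr0 expr0 mulr1.
apply: le_trans IH; rewrite exprS -mulrA mulrCA.
rewrite ler_wpM2l ?exprn_ge0//.
have : 0 <= N%:R * q ^+ 2 by rewrite mulr_ge0// sqr_ge0.
rewrite -natr1; nra.
Qed.

(** The margin [1/(n+1)] puts the case [z = x] on the side of the limit [0]. Since it shrinks like
    [1/n], the squared exponent [(n+1)^2] is what still leaves a divergence of order [n] there. *)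
Definition threshold_rate {R : realType} (x : R) (n : nat) : R :=
  (n.+1 ^ 2)%:R * ln 2 / (x + n.+1%:R^-1).

(* With [e] the exponent such that [2 ^ k * expR (- a z) = expR e], Bernoulli
   squeezes [(1 - expR (- a z)) ^+ 2 ^ k] between [1 - expR e] and
   [(1 + expR e)^-1]; the rate [a] is tuned so that [e] tends to [+oo] for
   [z <= x] and to [-oo] for [x < z]. *)
Lemma threshold_cvg (R : realType) (x z : R) : 0 <= x -> 0 <= z ->
  (1 - expR (- (threshold_rate x n * z))) ^+ (2 ^ (n.+1 ^ 2)) @[n --> \oo]
    --> ((x < z)%R%:R : R).
Proof.
move=> x0 z0; pose q n := expR (- (threshold_rate x n * z)).
have L0 : 0 < ln 2 :> R by apply: ln_gt0; lra.
have dP n : 0 < n.+1%:R^-1 :> R by rewrite invr_gt0.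
have d1 n : n.+1%:R^-1 <= 1 :> R by rewrite invf_le1// ler1n.
have a0 n : 0 <= threshold_rate x n.
  by rewrite /threshold_rate divr_ge0// ?mulr_ge0 ?addr_ge0// ltW.
have q01 n : 0 <= q n <= 1.
  by rewrite expR_ge0/= -expR0 ler_expR oppr_le0 mulr_ge0.
pose e n := (n.+1 ^ 2)%:R * ln 2 * ((x + n.+1%:R^-1 - z) / (x + n.+1%:R^-1)).
have Nq n : (2 ^ (n.+1 ^ 2))%:R * q n = expR (e n).
  rewrite natrX -[X in X ^+ _](@lnK R); last by rewrite posrE.
  rewrite -expRM_natl /q -expRD; congr expR.
  rewrite /e /threshold_rate.
  move: (n.+1%:R^-1) (dP n) (n.+1 ^ 2)%:R => D D0 K; field.
  by rewrite gt_eqF//; lra.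
have lo n : 1 - expR (e n) <= (1 - q n) ^+ (2 ^ (n.+1 ^ 2)).
  by rewrite -Nq onem_exp_ge.
have hi n : (1 - q n) ^+ (2 ^ (n.+1 ^ 2)) * (1 + expR (e n)) <= 1.
  by rewrite -Nq onem_exp_le.
have v0 n : 0 <= (1 - q n) ^+ (2 ^ (n.+1 ^ 2)).
  by have /andP[? ?] := q01 n; rewrite exprn_ge0// subr_ge0.
have v1 n : (1 - q n) ^+ (2 ^ (n.+1 ^ 2)) <= 1.
  by have /andP[? ?] := q01 n; rewrite exprn_ile1//; lra.
have sqE n : (n.+1 ^ 2)%:R = n.+1%:R * n.+1%:R :> R by rewrite natrX expr2.
have n0 n : 0 < n.+1%:R :> R by [].
have [xz|zx] := ltP x z.
(* [C] comes from [- e n >= (n+1) / C], valid once [1/(n+1) <= (z - x) / 2]; then [1 + y <= expR y]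
   yields [expR (e n) <= C / (n+1)]. *)
- pose C : R := (2 * (x + 1)) / (ln 2 * (z - x)).
  have C0 : 0 <= C by rewrite divr_ge0 ?mulr_ge0//; lra.
  apply: (@squeeze_cvgr _ _ _ _ (fun n => 1 - C * n.+1%:R^-1) (cst 1)); last 2 first.
  + rewrite -[X in _ --> X]subr0; apply: cvgB; first exact: cvg_cst.
    by rewrite -(mulr0 C); apply: cvgMr; exact: cvg_harmonic.
  + exact: cvg_cst.
  have e0 : 0 < (z - x) / 2 by lra.
  near=> n; rewrite v1 andbT; apply: le_trans (lo n).
  rewrite lerD2l lerN2.
  have en : C^-1 * n.+1%:R <= - e n.
    have dn : n.+1%:R^-1 <= (z - x) / 2.
      by apply: ltW; near: n; exact: (near_infty_natSinv_lt (PosNum e0)).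
    have m1 : 1 <= n.+1%:R :> R by rewrite ler1n.
    rewrite /e sqE /C; move: (n.+1%:R) dn m1 (dP n) (d1 n) => m dn m1 D0 D1.
    rewrite [leLHS](_ : _ = (m * ln 2) * (((z - x) / 2) / (x + 1))); last first.
      by field; rewrite !gt_eqF//; lra.
    rewrite [leRHS](_ : _ =
      (m * ln 2) * (m * (z - (x + m^-1)) / (x + m^-1))); last by ring.
    rewrite ler_wpM2l//; first by rewrite mulr_ge0//; lra.
    apply: ler_pM.
    * lra.
    * by rewrite invr_ge0; lra.
    * move: (m^-1) dn D0 D1 => D dn D0 D1; nra.
    * by rewrite lef_pV2 ?posrE//; lra.
  have C1 : 0 < C by rewrite divr_gt0 ?mulr_gt0//; lra.
  have nC : 0 < C^-1 * n.+1%:R by rewrite mulr_gt0 ?invr_gt0.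
  rewrite -[e n]opprK expRN -[C * _]invrK invfM invrK lef_pV2 ?posrE ?expR_gt0//.
  by have := expR_ge1Dx (- e n); lra.
- apply: (@squeeze_cvgr _ _ _ _ (cst 0) (fun n => (x + 1) / ln 2 * n.+1%:R^-1)); last 2 first.
  + exact: cvg_cst.
  + rewrite -[X in _ --> X](mulr0 ((x + 1) / ln 2)); apply: cvgMr; exact: cvg_harmonic.
  apply: nearW => n /=; rewrite v0/=.
  have en : ((x + 1) / ln 2)^-1 * n.+1%:R <= e n.
    have m1 : 1 <= n.+1%:R :> R by rewrite ler1n.
    rewrite /e sqE; move: (n.+1%:R) m1 (dP n) (d1 n) => m m1 D0 D1.
    rewrite [leLHS](_ : _ = (m * m * ln 2) * (m^-1 / (x + 1))); last first.
      by field; rewrite !gt_eqF//; lra.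
    rewrite ler_wpM2l//; first by rewrite !mulr_ge0//; lra.
    apply: ler_pM.
    * exact: ltW.
    * by rewrite invr_ge0; lra.
    * lra.
    * by rewrite lef_pV2 ?posrE//; lra.
  have C1 : 0 < (x + 1) / ln 2 by rewrite divr_gt0//; lra.
  have nC : 0 < ((x + 1) / ln 2)^-1 * n.+1%:R by rewrite mulr_gt0 ?invr_gt0.
  have CE : (((x + 1) / ln 2)^-1 * n.+1%:R)^-1 = (x + 1) / ln 2 / n.+1%:R.
    by rewrite [LHS]invfM invrK.
  rewrite -CE -[leRHS]mul1r ler_pdivlMr//.
  apply: le_trans (hi n); apply: ler_wpM2l; first exact: v0.
  apply: (le_trans en).
  by have := expR_ge1Dx (e n); lra.
Unshelve. all: by end_near.
Qed.

(** * From Laplace functionals to measures *)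

Lemma bounded_cvg_integral {d : measure_display} {T : measurableType d}
    {R : realType} (P : probability T R) (f_ : nat -> T -> R) (f : T -> R)
    (M : R) :
  (forall n, measurable_fun setT (f_ n)) -> (forall n x, `|f_ n x| <= M) ->
  (forall x, f_ n x @[n --> \oo] --> f x) ->
  (\int[P]_x (f_ n x)%:E)%E @[n --> \oo] --> (\int[P]_x (f x)%:E)%E.
Proof.
move=> mf fM cf; have mf' : measurable_fun setT f.
  by apply: (measurable_fun_cvg mf) => x _; exact: cf.
have [] := @dominated_convergence _ _ _ P setT measurableT
  (fun n x => (f_ n x)%:E) (fun x => (f x)%:E) (cst M%:E) => //.
- by move=> n; exact/measurable_EFinP.
- exact/measurable_EFinP.
- by apply: aeW => x _; apply/cvg_EFin; [exact: nearW|exact: cf].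
- apply: (bounded_integrable P (cst M) `|M|) => //.
- by apply: aeW => x n _; rewrite lee_fin.
Qed.

Lemma integral_indicator {d : measure_display} {T : measurableType d}
    {R : realType} (P : probability T R) (A : set T) (f : T -> R) (b : T -> bool) :
  (forall w, b w <-> A w) ->
  (\int[P]_(w in A) (f w)%:E = \int[P]_w (f w * (b w)%:R)%:E)%E.
Proof.
move=> bA; rewrite integral_mkcond; apply: eq_integral => w _.
rewrite patchE; case: ifPn => [/set_mem /bA ->|]; first by rewrite mulr1.
by case: (boolP (b w)) => [/bA|_ _]; rewrite ?mulr0// => /mem_set ->.
Qed.

Section laplace_uniqueness.
Context {d : measure_display} {T : measurableType d} {R : realType}.
Context (P : probability T R) (O I : Type) (p q : T -> O) (J : pred I).
Context (F : I -> O -> R) (u v : T -> R) (M : R).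
Hypothesis mFp : forall i, J i -> measurable_fun setT (F i \o p).
Hypothesis mFq : forall i, J i -> measurable_fun setT (F i \o q).
Hypothesis F0 : forall i o, J i -> 0 <= F i o.
Hypotheses (mu : measurable_fun setT u) (mv : measurable_fun setT v).
Hypotheses (uM : forall w, `|u w| <= M) (vM : forall w, `|v w| <= M).

Let ok (l : seq (I * R)) := all (fun x => J x.1 && (0 <= x.2)) l.
Let lap (l : seq (I * R)) (o : O) := expR (- \sum_(x <- l) x.2 * F x.1 o).

Hypothesis laplace_eq : forall l, ok l ->
  (\int[P]_w (u w * lap l (p w))%:E = \int[P]_w (v w * lap l (q w))%:E)%E.

Let measurable_lap (r : T -> O) l :
  (forall i, J i -> measurable_fun setT (F i \o r)) -> ok l ->
  measurable_fun setT (fun w => lap l (r w)).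
Proof.
move=> mF okl; apply: measurableT_comp; first exact: measurable_expR.
apply: measurable_funN; elim: l okl => [_|[i c] l IH /= /andP[/andP[Ji _] okl]].
  by under eq_fun do rewrite big_nil; exact: measurable_cst.
under eq_fun do rewrite big_cons; apply: measurable_funD; last exact: IH.
by apply: measurable_funM; [exact: measurable_cst|exact: mF].
Qed.

Let lap_ge0 l o : 0 <= lap l o. Proof. exact: expR_ge0. Qed.

Let lap_le1 l o : ok l -> lap l o <= 1.
Proof.
move=> okl; rewrite -expR0 ler_expR oppr_le0.
elim: l okl => [_|[i c] l IH /= /andP[/andP[Ji c0] okl]]; first by rewrite big_nil.
by rewrite big_cons addr_ge0 ?IH// mulr_ge0 ?F0.
Qed.

(** Quantifying over every [l] keeps a free exponential factor in reserve: this is what lets a new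
    factor [expR (- (c * F i o))] be absorbed when it multiplies [A]. *)
Let agree (A : O -> R) := [/\ measurable_fun setT (A \o p),
  measurable_fun setT (A \o q), forall o, 0 <= A o <= 1 &
  forall l, ok l -> (\int[P]_w (u w * A (p w) * lap l (p w))%:E =
                    \int[P]_w (v w * A (q w) * lap l (q w))%:E)%E].

Let agree_cvg (A_ : nat -> O -> R) A : (forall n, agree (A_ n)) ->
  (forall o, A_ n o @[n --> \oo] --> A o) -> agree A.
Proof.
move=> aA cA; split.
- apply: (@measurable_fun_cvg _ _ _ _ (fun n => A_ n \o p)) => [n|w _].
    by case: (aA n).
  exact: cA.
- apply: (@measurable_fun_cvg _ _ _ _ (fun n => A_ n \o q)) => [n|w _].
    by case: (aA n).
  exact: cA.
- move=> o; apply/andP; split.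
    apply: (cvgr_to_ge (cA o)).
    by apply: nearW => n; have [_ _ /(_ o)/andP[]] := aA n.
  apply: (cvgr_to_le (cA o)).
  by apply: nearW => n; have [_ _ /(_ o)/andP[]] := aA n.
- move=> l okl.
  have key (r : T -> O) (k : T -> R) : measurable_fun setT k ->
      (forall w, `|k w| <= M) ->
      (forall i, J i -> measurable_fun setT (F i \o r)) ->
      (forall n, measurable_fun setT (A_ n \o r)) ->
      (\int[P]_w (k w * A_ n (r w) * lap l (r w))%:E)%E @[n --> \oo] -->
      (\int[P]_w (k w * A (r w) * lap l (r w))%:E)%E.
    move=> mk kM mF mA; apply: (@bounded_cvg_integral _ _ _ _ _ _ M).
    + move=> n; apply: measurable_funM; last exact: measurable_lap.
      by apply: measurable_funM => //; exact: mA.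
    + move=> n w; have [_ _ /(_ (r w))/andP[a0 a1] _] := aA n.
      rewrite !normrM (ger0_norm a0) (ger0_norm (lap_ge0 _ _)).
      rewrite -[leRHS]mulr1 -[leRHS]mulr1.
      by rewrite !ler_pM ?mulr_ge0//; exact: lap_le1.
    + move=> w; apply: cvgMl; apply: cvgMr; exact: cA.
  have c1 := key p u mu uM mFp (fun n => let: And4 h _ _ _ := aA n in h).
  have c2 := key q v mv vM mFq (fun n => let: And4 _ h _ _ := aA n in h).
  apply: (cvg_unique _ c1) => //.
  apply: cvg_trans c2; apply: near_eq_cvg; near=> n.
  by have [_ _ _ ->] := aA n.
Unshelve. all: by end_near.
Qed.

Let agree_1 : agree (fun=> 1).
Proof.
split; [exact: measurable_cst|exact: measurable_cst| |].
  by move=> o; rewrite ler01 lexx.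
by move=> l okl; under eq_integral do rewrite mulr1;
   under [RHS]eq_integral do rewrite mulr1; exact: laplace_eq.
Qed.

(** The product expands into two terms; the exponential of the second becomes one more entry
    [(i, c)] of the list in [lap]. *)
Let agree_onem A i c : agree A -> J i -> 0 <= c ->
  agree (fun o => A o * (1 - expR (- (c * F i o)))).
Proof.
move=> [mAp mAq A01 Aeq] Ji c0.
have m1 (r : T -> O) : measurable_fun setT (F i \o r) ->
    measurable_fun setT (fun w => 1 - expR (- (c * F i (r w)))).
  move=> mF; apply: measurable_funB; first exact: measurable_cst.
  apply: measurableT_comp; first exact: measurable_expR.
  by apply: measurable_funN; apply: measurable_funM => //; exact: measurable_cst.
have e01 o : 0 <= 1 - expR (- (c * F i o)) <= 1.
  have : 0 < expR (- (c * F i o)) <= 1.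
    by rewrite expR_gt0 -expR0 ler_expR oppr_le0 mulr_ge0 ?F0.
  by move=> /andP[? ?]; lra.
split.
- by apply: measurable_funM => //; exact/m1/mFp.
- by apply: measurable_funM => //; exact/m1/mFq.
- move=> o; have /andP[? ?] := A01 o; have /andP[? ?] := e01 o.
  by rewrite mulr_ge0//= mulr_ile1.
- move=> l okl.
  have okl' : ok ((i, c) :: l) by rewrite /ok /= Ji c0.
  have key (r : T -> O) (k : T -> R) : measurable_fun setT k ->
      (forall w, `|k w| <= M) ->
      (forall i, J i -> measurable_fun setT (F i \o r)) ->
      measurable_fun setT (A \o r) ->
      (\int[P]_w (k w * (A (r w) * (1 - expR (- (c * F i (r w))))) *
          lap l (r w))%:E =
       \int[P]_w (k w * A (r w) * lap l (r w))%:E -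
       \int[P]_w (k w * A (r w) * lap ((i, c) :: l) (r w))%:E)%E.
    move=> mk kM mF mA.
    rewrite -integralB_EFin//; first last.
    + apply: (@bounded_integrable _ _ _ _ _ M).
        apply: measurable_funM; last exact: measurable_lap.
        by apply: measurable_funM.
      move=> w; have /andP[a0 a1] := A01 (r w).
      rewrite !normrM (ger0_norm a0) (ger0_norm (lap_ge0 _ _)).
      rewrite -[leRHS]mulr1 -[leRHS]mulr1.
      by rewrite !ler_pM ?mulr_ge0//; exact: lap_le1.
    + apply: (@bounded_integrable _ _ _ _ _ M).
        apply: measurable_funM; last exact: measurable_lap.
        by apply: measurable_funM.
      move=> w; have /andP[a0 a1] := A01 (r w).
      rewrite !normrM (ger0_norm a0) (ger0_norm (lap_ge0 _ _)).
      rewrite -[leRHS]mulr1 -[leRHS]mulr1.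
      by rewrite !ler_pM ?mulr_ge0//; exact: lap_le1.
    apply: eq_integral => w _; rewrite -EFinB; congr EFin.
    rewrite /lap big_cons opprD expRD/=; ring.
  by rewrite (key p u)// (key q v)// Aeq// Aeq.
Qed.

Let agree_onemX A i c N : agree A -> J i -> 0 <= c ->
  agree (fun o => A o * (1 - expR (- (c * F i o))) ^+ N).
Proof.
move=> aA Ji c0; elim: N => [|N IH].
  by under eq_fun do rewrite expr0 mulr1.
by under eq_fun do rewrite exprSr mulrA; exact: agree_onem.
Qed.

(** A bounded limit of the powers in [agree_onemX] along [threshold_rate]. For [x < 0] the indicator
    is constantly [1], because [F] is nonnegative. *)
Let agree_gt A i x : agree A -> J i ->
  agree (fun o => A o * (x < F i o)%R%:R).
Proof.
move=> aA Ji; have [x0|x0] := ltP x 0.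
  suff -> : (fun o => A o * (x < F i o)%R%:R) = A by [].
  apply/funext => o; suff -> : x < F i o by rewrite mulr1.
  by rewrite (lt_le_trans x0)// F0.
apply: (@agree_cvg (fun n o => A o *
  (1 - expR (- (threshold_rate x n * F i o))) ^+ (2 ^ (n.+1 ^ 2)))).
  move=> n; apply: agree_onemX => //.
  rewrite /threshold_rate divr_ge0 ?mulr_ge0 ?addr_ge0//.
  by apply/ltW/ln_gt0; lra.
by move=> o; apply: cvgMr; apply: threshold_cvg => //; exact: F0.
Qed.

(** Lists turn stability under intersection into concatenation. *)
Let rays : set (set O) := [set A | exists l : seq (I * R),
  all (fun x => J x.1) l /\ A = [set o | all (fun x => x.2 < F x.1 o) l]].

Let agree_rays l : all (fun x : I * R => J x.1) l ->
  agree (fun o => (all (fun x => x.2 < F x.1 o) l)%:R).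
Proof.
elim: l => [_|[i x] l IH /= /andP[Ji Jl]] /=; first exact: agree_1.
under eq_fun => o do rewrite andbC.
have -> : (fun o => (all (fun y : I * R => y.2 < F y.1 o) l && (x < F i o))%:R) =
  (fun o => (all (fun y : I * R => y.2 < F y.1 o) l)%:R * (x < F i o)%R%:R :> R).
  by apply/funext => o; rewrite -mulnb natrM.
by apply: agree_gt => //; exact: IH.
Qed.

Let raysI : setI_closed rays.
Proof.
move=> _ _ [l1 [J1 ->]] [l2 [J2 ->]]; exists (l1 ++ l2); rewrite all_cat J1 J2.
split=> //; apply/seteqP; split=> o /=; rewrite all_cat.
  by move=> [-> ->].
by move=> /andP[].
Qed.

Let measurable_preimage_gt (r : T -> O) l :
  (forall i, J i -> measurable_fun setT (F i \o r)) ->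
  all (fun x : I * R => J x.1) l ->
  measurable (r @^-1` [set o | all (fun x : I * R => x.2 < F x.1 o) l]).
Proof.
move=> mF; elim: l => [_|[i x] l IH /= /andP[Ji Jl]].
  by rewrite (_ : _ @^-1` _ = setT)//; apply/seteqP; split.
rewrite (_ : _ @^-1` _ = (F i \o r) @^-1` `]x, +oo[%classic `&`
  r @^-1` [set o | all (fun x : I * R => x.2 < F x.1 o) l]); last first.
  apply/seteqP; split=> w /=; rewrite in_itv/= andbT.
    by move=> /andP[].
  by move=> [-> ->].
apply: measurableI; last exact: IH.
by rewrite -[X in measurable X]setTI; exact: mF.
Qed.

Let cyl : set (set O) := [set A | exists i, J i /\ exists B : set R,
  measurable B /\ A = F i @^-1` B].

Let cyl_rays : <<s cyl >> `<=` <<s rays >>.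
Proof.
apply: smallest_sub; first exact: smallest_sigma_algebra.
move=> _ [i [Ji [B [mB ->]]]].
have [S0 SC SU] := smallest_sigma_algebra setT rays.
pose H : set (set R) := [set B | <<s rays >> (F i @^-1` B)].
move: mB; rewrite [measurable](RGenOInfty.measurableE R) => mB.
apply: (mB H); split.
  split.
  - by rewrite /H /= preimage_set0.
  - by move=> C HC; exact: (SC _ HC).
  - move=> C HC; by rewrite /H /= preimage_bigcup; exact: SU.
move=> _ [x ->]; apply: sub_sigma_algebra; exists [:: (i, x)]; rewrite /= Ji.
split=> //; apply/seteqP; split=> o /=; rewrite in_itv/= !andbT//.
Qed.

(** Agreement passes from Laplace functionals to indicators of finite intersections of rays, a
    pi-system whose sigma-algebra contains [cyl]. Two maps [p], [q] and two densities [u], [v] allow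
    processes under two changes of measure to be compared. *)
Lemma laplace_uniqueness A : <<s cyl >> A ->
  [/\ measurable (p @^-1` A), measurable (q @^-1` A) &
   (\int[P]_(w in p @^-1` A) (u w)%:E = \int[P]_(w in q @^-1` A) (v w)%:E)%E].
Proof.
move=> /cyl_rays; apply: dynkin_integral_eq.
- exact: raysI.
- by move=> _ [l [Jl ->]]; split; exact: measurable_preimage_gt.
- exact: bounded_integrable uM.
- exact: bounded_integrable vM.
- have := laplace_eq [::] isT; rewrite /lap.
  under eq_integral do rewrite big_nil oppr0 expR0 mulr1.
  by under [X in _ = X]eq_integral do rewrite big_nil oppr0 expR0 mulr1.
- move=> _ [l [Jl ->]].
  rewrite (@integral_indicator _ _ _ _ _ _
    (fun w => all (fun x : I * R => x.2 < F x.1 (p w)) l))//.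
  rewrite (@integral_indicator _ _ _ _ (q @^-1` _) _
    (fun w => all (fun x : I * R => x.2 < F x.1 (q w)) l))//.
  have [_ _ _ /(_ [::] isT)] := agree_rays l Jl; rewrite /lap.
  under eq_integral do rewrite big_nil oppr0 expR0 mulr1.
  by under [X in _ = X]eq_integral do rewrite big_nil oppr0 expR0 mulr1.
Qed.

End laplace_uniqueness.

(** * Independence and factorisation of integrals *)

Definition indep_rv {d : measure_display} {T : measurableType d} {R : realType}
    (P : probability T R) (U V : T -> R) :=
  forall A B : set R, measurable A -> measurable B ->
  P (U @^-1` A `&` V @^-1` B) = (P (U @^-1` A) * P (V @^-1` B))%E.

Lemma indep_rv_comp {d : measure_display} {T : measurableType d} {R : realType}
    (P : probability T R) (U V : T -> R) (a b : R -> R) :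
  measurable_fun setT a -> measurable_fun setT b ->
  indep_rv P U V -> indep_rv P (a \o U) (b \o V).
Proof.
move=> ma mb UV A B mA mB.
rewrite (comp_preimage A U a) (comp_preimage B V b) UV//.
  by rewrite -[X in measurable X]setTI; exact: ma.
by rewrite -[X in measurable X]setTI; exact: mb.
Qed.

Lemma ge0_indep_integralM {d : measure_display} {T : measurableType d}
    {R : realType} (P : probability T R) (U V : T -> R) :
  measurable_fun setT U -> measurable_fun setT V ->
  (forall w, 0 <= U w) -> (forall w, 0 <= V w) -> indep_rv P U V ->
  (\int[P]_w (U w * V w)%:E = \int[P]_w (U w)%:E * \int[P]_w (V w)%:E)%E.
Proof.
move=> mU mV U0 V0 UV.
pose X : {mfun T >-> R} := HB.pack U (isMeasurableFun.Build _ _ _ _ U mU).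
pose Y : {mfun T >-> R} := HB.pack V (isMeasurableFun.Build _ _ _ _ V mV).
have mXY : measurable_fun setT (fun w => (X w, Y w)).
  exact: measurable_fun_pair.
pose XY : {mfun T >-> (R * R)%type} :=
  HB.pack (fun w => (X w, Y w)) (isMeasurableFun.Build _ _ _ _ _ mXY).
have mn : measurable_fun setT (fun x : R => `|x|%:E).
  by apply/measurable_EFinP; exact: normr_measurable.
(* [U] and [V] are nonnegative on [T], but the change of variables wants an integrand nonnegative on
   all of [R]; absolute values therefore replace the identity. *)
have absE (Z : {mfun T >-> R}) : (forall w, 0 <= Z w) ->
    (\int[distribution P Z]_x `|x|%:E = \int[P]_w (Z w)%:E)%E.
  move=> Z0; rewrite ge0_integral_distribution//=.
  by apply: eq_integral => w _ /=; rewrite ger0_norm.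
have mprod : measurable_fun setT (fun z : R * R => (`|z.1| * `|z.2|)%:E).
  apply/measurable_EFinP; apply: measurable_funM.
  - by apply: measurableT_comp => //; exact: normr_measurable.
  - by apply: measurableT_comp => //; exact: normr_measurable.
transitivity (\int[distribution P XY]_z (`|z.1| * `|z.2|)%:E)%E.
  rewrite ge0_integral_distribution//=.
  by apply: eq_integral => w _ /=; rewrite !ger0_norm.
(* Independence on rectangles identifies the joint law with the product of the marginals; Tonelli
   then separates the variables. *)
rewrite (@eq_measure_integral _ _ _ _
  (distribution P X \x distribution P Y)%E); last first.
  by move=> A mA _; apply/esym; exact: product_measure_unique.
rewrite fubini_tonelli1//=.
rewrite /fubini_F /=.
under eq_integral do (under eq_integral do rewrite EFinM;
  rewrite ge0_integralZl ?lee_fin// absE//).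
rewrite ge0_integralZr// ?absE//.
by apply: integral_ge0 => w _; rewrite lee_fin.
Qed.

(** Since [U] is nonnegative, the positive and negative parts of [U * V] are [U] times those of [V],
    which reduces the claim to the nonnegative case. *)
Lemma indep_integralM {d : measure_display} {T : measurableType d}
    {R : realType} (P : probability T R) (U V : T -> R) :
  measurable_fun setT U -> measurable_fun setT V -> (forall w, 0 <= U w <= 1) ->
  P.-integrable setT (EFin \o V) -> indep_rv P U V ->
  (\int[P]_w (U w * V w)%:E = \int[P]_w (U w)%:E * \int[P]_w (V w)%:E)%E.
Proof.
move=> mU mV U01 iV UV.
pose pos (x : R) := Num.max x 0; pose neg (x : R) := Num.max (- x) 0.
have mpos : measurable_fun setT pos by apply: measurable_maxr => //; exact: measurable_cst.
have mneg : measurable_fun setT neg.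
  by apply: measurable_maxr; [exact: measurable_funN|exact: measurable_cst].
have U0 w : 0 <= U w by case/andP: (U01 w).
have fP : (fun w => (V w)%:E)^\+%E = (fun w => (pos (V w))%:E).
  by apply/funext => w; rewrite funeposE /pos -EFin_max.
have fN : (fun w => (V w)%:E)^\-%E = (fun w => (neg (V w))%:E).
  by apply/funext => w; rewrite funenegE /neg -EFinN -EFin_max.
have gP : (fun w => (U w * V w)%:E)^\+%E = (fun w => (U w * pos (V w))%:E).
  by apply/funext => w; rewrite funeposE /pos -EFin_max maxr_pMr// mulr0.
have gN : (fun w => (U w * V w)%:E)^\-%E = (fun w => (U w * neg (V w))%:E).
  by apply/funext => w; rewrite funenegE /neg -EFinN -EFin_max maxr_pMr// mulr0 mulrN.
rewrite integralE [X in (_ * X)%E]integralE gP gN fP fN.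
rewrite !ge0_indep_integralM//.
- have aF : (\int[P]_w (U w)%:E)%E \is a fin_num.
    apply: integrable_fin_num => //; apply: (bounded_integrable _ _ 1) => //.
    by move=> w; have /andP[? ?] := U01 w; rewrite ger0_norm.
  have cF : (\int[P]_w (neg (V w))%:E)%E \is a fin_num.
    by rewrite -fN; apply: integrable_fin_num => //; exact: integrable_funeneg.
  move: (\int[P]_w (U w)%:E)%E (\int[P]_w (neg (V w))%:E)%E
    (\int[P]_w (pos (V w))%:E)%E aF cF => a c b aF cF.
  by rewrite muleBr// fin_num_adde_defl// fin_numN.
- exact: measurableT_comp.
- by move=> w; rewrite /neg le_max lexx orbT.
- exact: (indep_rv_comp _ _ _ id).
- exact: measurableT_comp.
- by move=> w; rewrite /pos le_max lexx orbT.
- exact: (indep_rv_comp _ _ _ id).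
Qed.

Lemma measurable_g_sigma {T : pointedType} {R : realType} (G : set (set T))
    (f : T -> R) (B : set R) :
  @measurable_fun _ _ (g_sigma_algebraType G) R setT f -> measurable B ->
  <<s G >> (f @^-1` B).
Proof. by move=> mf mB; have := mf measurableT B mB; rewrite setTI. Qed.

Section finite_independence.
Context {d : measure_display} {T : measurableType d} {R : realType}.
Context (P : probability T R) (Z : nat -> T -> R).
Hypothesis mZ : forall i, measurable_fun setT (Z i).

Definition indep_upto (n : nat) := forall Bs : nat -> set R,
  (forall i, measurable (Bs i)) ->
  P (\bigcap_(i in `I_n) [set w | Bs i (Z i w)]) =
  (\prod_(i < n) P [set w | Bs i (Z i w)])%E.

Let mZB i (B : set R) : measurable B -> measurable [set w | B (Z i w)].
Proof. by move=> mB; rewrite -[X in measurable X]setTI; exact: mZ. Qed.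

Lemma indep_uptoW n : indep_upto n.+1 -> indep_upto n.
Proof.
move=> ind Bs mBs.
pose Cs i := if (i < n)%N then Bs i else setT.
have mCs i : measurable (Cs i) by rewrite /Cs; case: ifP.
have CsT : [set w | Cs n (Z n w)] = setT.
  by rewrite /Cs ltnn; apply/seteqP; split.
have := ind Cs mCs; rewrite big_ord_recr/= CsT.
rewrite probability_setT mule1.
have -> : \bigcap_(i in `I_n.+1) [set w | Cs i (Z i w)] =
          \bigcap_(i in `I_n) [set w | Bs i (Z i w)].
  apply/seteqP; split=> w /= h i /= ni.
    by have /= := h i (ltnW ni); rewrite /Cs ni.
  by rewrite /Cs; case: ifPn => // ni'; exact: h.
by move=> ->; apply: eq_bigr => i _; rewrite /Cs ltn_ord.
Qed.

(** The variables before [Z n] generate through a pi-system of finite cylinders, on which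
    independence is the hypothesis. The Dynkin comparison is run with the indicator of the event
    that [Z n] lies in [B], against the constant equal to its probability. *)
Lemma indep_upto_rv n (c : nat -> R) : indep_upto n.+1 ->
  indep_rv P (fun w => \sum_(i < n) c i * Z i w) (Z n).
Proof.
move=> ind A B mA mB; have indn := indep_uptoW _ ind.
pose G : set (set T) := [set D | exists Bs : nat -> set R,
  (forall i, measurable (Bs i)) /\ D = \bigcap_(i in `I_n) [set w | Bs i (Z i w)]].
have mG D : G D -> measurable D.
  by move=> [Bs [mBs ->]]; apply: fin_bigcap_measurable => // k _; exact: mZB.
have GI : setI_closed G.
  move=> _ _ [Bs [mBs ->]] [Cs [mCs ->]]; exists (fun i => Bs i `&` Cs i).
  split; first by move=> i; exact: measurableI.
  by rewrite -bigcapI; apply: eq_bigcapr => i _.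
have mS : @measurable_fun _ _ (g_sigma_algebraType G) R setT
    (fun w => \sum_(i < n) c i * Z i w).
  apply: measurable_sum => i; apply: measurable_funM; first exact: measurable_cst.
  move=> _ D mD; rewrite setTI; apply: sub_sigma_algebra.
  exists (fun j : nat => if j == i :> nat then D else setT); split; first by move=> j; case: ifP.
  apply/seteqP; split=> w /=.
    by move=> Dw j /= _; case: ifPn => // /eqP ->.
  by move=> /(_ i (ltn_ord i)) /=; rewrite eqxx.
have mZn : measurable (Z n @^-1` B) by exact: mZB.
have PE D : measurable D -> P D = (fine (P D))%:E.
  by move=> mD; rewrite fineK// fin_num_measure.
have key D : measurable D ->
  (\int[P]_(w in D) (\1_(Z n @^-1` B) w)%:E = P (D `&` Z n @^-1` B))%E.
  by move=> mD; rewrite integral_indic// setIC.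
have keyc D : measurable D ->
  (\int[P]_(w in D) (fine (P (Z n @^-1` B)))%:E = P D * P (Z n @^-1` B))%E.
  by move=> mD; rewrite integral_cst// muleC -PE.
have [||||||mD _] := @dynkin_integral_eq _ _ _ P T id id G
  (\1_(Z n @^-1` B)) (cst (fine (P (Z n @^-1` B)))) GI _ _ _ _ _
  ((fun w => \sum_(i < n) c i * Z i w) @^-1` A).
- by move=> D /mG.
- by apply: (bounded_integrable _ _ 1) => // w; rewrite indicE; case: (_ \in _); rewrite ?normr1 ?normr0.
- by apply: (bounded_integrable _ _ `|fine (P (Z n @^-1` B))|).
- by rewrite key// keyc// setTI probability_setT mul1e.
- move=> D GD; have mD := mG _ GD; rewrite /= !preimage_id key// keyc//.
  case: GD => Bs [mBs ->].
  pose Cs i := if i == n then B else Bs i.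
  have mCs i : measurable (Cs i) by rewrite /Cs; case: ifP.
  have CsB : Cs n = B by rewrite /Cs eqxx.
  have := ind Cs mCs; rewrite big_ord_recr/= CsB => h.
  transitivity (P (\bigcap_(i in `I_n.+1) [set w | Cs i (Z i w)])).
    congr (P _); apply/seteqP; split=> w /=.
      move=> [Bw Bn] i /=; rewrite ltnS leq_eqVlt /Cs.
      by case: ifPn => [/eqP ->//|_ /= ni]; exact: Bw.
    move=> h'; split; last by have := h' n (leqnn _); rewrite /= CsB.
    move=> i /= ni; have := h' i (ltnW ni); rewrite /Cs /=.
    by rewrite (ltn_eqF ni).
  rewrite h indn//; congr (_ * _)%E; apply: eq_bigr => i _.
  by rewrite /Cs (ltn_eqF (ltn_ord i)).
- exact: measurable_g_sigma.
- by rewrite !preimage_id key// keyc.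
Qed.

End finite_independence.

(** * Laplace functional of the gamma process *)

Section gamma_laplace.
Context {d : measure_display} {T : measurableType d} {R : realType}.
Context (P : probability T R) (g : R -> T -> R).
Hypothesis gp : standard_gamma_process P g.
Implicit Types (l : seq (R * R)) (s : R).

Lemma gamma_ge0 s w : 0 <= s -> 0 <= g s w.
Proof.
by case: gp => _ [g0 [gm _]] s0; rewrite -(g0 w); exact: gm.
Qed.

Let mg s : 0 <= s -> measurable_fun setT (g s).
Proof. by case: gp => mg _; exact: mg. Qed.

(** The last increment is independent of the combination of the previous ones, so the integral
    factors one increment at a time. *)
Lemma gamma_laplace_increments (n : nat) (ts C : nat -> R) :
  0 <= ts 0%N -> (forall i, ts i <= ts i.+1) -> (forall i, 0 <= C i) ->
  (\int[P]_w (expR (- \sum_(i < n) C i * (g (ts i.+1) w - g (ts i) w)))%:E =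
   (\prod_(i < n) (1 + C i) `^ (- (ts i.+1 - ts i)))%:E)%E.
Proof.
case: gp => _ [_ [gm [_ [_ [gind glap]]]]] t0 tm C0.
have ts0 i : 0 <= ts i by elim: i => // i IH; exact: le_trans (tm i).
pose Z i w := g (ts i.+1) w - g (ts i) w.
have mZ i : measurable_fun setT (Z i) by apply: measurable_funB; exact: mg.
have Z0 i w : 0 <= Z i w by rewrite subr_ge0; exact: gm.
elim: n => [|n IH].
  under eq_integral do rewrite big_ord0 oppr0 expR0.
  by rewrite big_ord0 integral_cst// [X in (_ * X)%E]probability_setT mule1.
under eq_integral do rewrite big_ord_recr/= opprD expRD.
rewrite indep_integralM.
- by rewrite IH glap// big_ord_recr/= EFinM.
- apply: measurableT_comp; first exact: measurable_expR.
  apply: measurable_funN; apply: measurable_sum => i.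
  by apply: measurable_funM; [exact: measurable_cst|exact: mZ].
- apply: measurableT_comp; first exact: measurable_expR.
  apply: measurable_funN.
  by apply: measurable_funM; [exact: measurable_cst|exact: mZ].
- move=> w; rewrite expR_ge0/= -expR0 ler_expR oppr_le0 sumr_ge0// => i _.
  by rewrite mulr_ge0//; exact: Z0.
- apply: (bounded_integrable _ _ 1).
    apply: measurableT_comp; first exact: measurable_expR.
    apply: measurable_funN.
    by apply: measurable_funM; [exact: measurable_cst|exact: mZ].
  move=> w; rewrite ger0_norm ?expR_ge0// -expR0 ler_expR oppr_le0.
  by rewrite mulr_ge0//; exact: Z0.
- have ind : indep_upto P Z n.+1 by move=> Bs mBs; exact: gind.
  have := indep_upto_rv _ _ mZ n C ind.
  apply: (@indep_rv_comp _ _ _ _ _ _ (fun x => expR (- x))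
    (fun x => expR (- (C n * x)))).
  + by apply: measurableT_comp => //; exact: measurable_expR.
  + apply: measurableT_comp; first exact: measurable_expR.
    by apply: measurable_funN; apply: measurable_funM => //; exact: measurable_cst.
Qed.

(** Past the end of [l] the sequence stays at its last time: the assumption of independent
    increments asks for monotonicity along all of [nat]. *)
Fixpoint times s l (i : nat) : R :=
  if l is x :: l' then (if i is i'.+1 then times x.1 l' i' else s) else s.

Definition tail_coef l (i : nat) : R := \sum_(x <- drop i l) x.2.

Let times0 s l : times s l 0 = s. Proof. by case: l. Qed.

Let times_mono s l : path (fun x y : R * R => x.1 <= y.1) (s, 0) l ->
  forall i, times s l i <= times s l i.+1.
Proof.
elim: l s => [//|[r c] l IH] s /= /andP[sr pl] [|i]; first by rewrite times0.
by apply: IH; move: pl; case: (l).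
Qed.

(* Abel summation: the coefficient of an increment is the total coefficient of
   the later times. *)
Let sum_increments s l (f : R -> R) :
  \sum_(i < size l) tail_coef l i * (f (times s l i.+1) - f (times s l i)) =
  \sum_(x <- l) x.2 * (f x.1 - f s).
Proof.
elim: l s => [|[r c] l IH] s; first by rewrite big_ord0 big_nil.
rewrite [LHS]big_ord_recl big_cons.
rewrite [X in _ + X](_ : _ = \sum_(i < size l) tail_coef l i *
  (f (times r l i.+1) - f (times r l i))); last exact: eq_bigr.
rewrite (IH r) /= times0 /tail_coef drop0 big_cons/= mulrDl -addrA; congr (_ + _).
rewrite mulr_suml -big_split/=; apply: eq_bigr => x _; ring.
Qed.

(** For [s = 0], nondecreasing times and nonnegative coefficients this is the closed form of
    [gamma_laplace]; the base time [s] is left free for inductions on [l]. *)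
Let laplace_value s l : R :=
  \prod_(i < size l) (1 + tail_coef l i) `^ (- (times s l i.+1 - times s l i)).

Let laplace_value_cons s x l : laplace_value s (x :: l) =
  (1 + (x.2 + \sum_(y <- l) y.2)) `^ (- (x.1 - s)) * laplace_value x.1 l.
Proof.
rewrite /laplace_value /= big_ord_recl/= /tail_coef drop0 big_cons times0.
by congr (_ * _).
Qed.

Definition gamma_laplace l : \bar R :=
  (\int[P]_w (expR (- \sum_(x <- l) x.2 * g x.1 w))%:E)%E.

Let laplaceE l : path (fun x y : R * R => x.1 <= y.1) (0, 0) l ->
  all (fun x => 0 <= x.2) l -> gamma_laplace l = (laplace_value 0 l)%:E.
Proof.
case: gp => _ [g0 _] pl l0; rewrite /laplace_value -gamma_laplace_increments.
- apply: eq_integral => w _.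
  rewrite (sum_increments 0 l (fun s => g s w)) g0.
  by under [in RHS]eq_bigr do rewrite subr0.
- by rewrite times0.
- exact: times_mono.
- move=> i; rewrite /tail_coef; have : all (fun x => 0 <= x.2) (drop i l).
    by move: l0; rewrite -{1}(cat_take_drop i l) all_cat => /andP[].
  elim: (drop i l) => [|x l' IH]; first by rewrite big_nil.
  by move=> /= /andP[x0 /IH]; rewrite big_cons; exact: addr_ge0.
Qed.

Let total_coef_ge0 l : all (fun x => 0 <= x.2) l -> 0 <= \sum_(x <- l) x.2.
Proof.
elim: l => [|x l IH] /=; first by rewrite big_nil.
by move=> /andP[x0 /IH]; rewrite big_cons; exact: addr_ge0.
Qed.

(** The base time enters only the first increment, whose tail coefficient is the full sum; the
    exponents add whatever the sign of [r - s]. *)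
Let laplace_value_shift s r l : all (fun x => 0 <= x.2) l ->
  laplace_value s l =
  (1 + \sum_(x <- l) x.2) `^ (- (r - s)) * laplace_value r l.
Proof.
case: l => [|x l] l0.
  by rewrite big_nil addr0 powR1 mul1r /laplace_value !big_ord0.
have /total_coef_ge0 t0 := l0; rewrite !laplace_value_cons.
rewrite big_cons in t0 *.
have {}t0 : 1 + (x.2 + \sum_(y <- l) y.2) != 0 by rewrite gt_eqF// ltr_pwDl.
rewrite mulrA -powRD; last by rewrite t0 implybT.
by congr (_ `^ _ * _); ring.
Qed.

(** With [t] the total of [l2], an increment of [l1] with tail coefficient [c] contributes the base
    [1 + c + t = (1 + t) (1 + c / (1 + t))]. The powers of [1 + t] so collected move the base time
    of [l2] back to [s]. *)
Let laplace_value_cat s l1 l2 :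
  all (fun x => 0 <= x.2) l1 -> all (fun x => 0 <= x.2) l2 ->
  laplace_value s (l1 ++ l2) = laplace_value s l2 *
    laplace_value s [seq (x.1, x.2 / (1 + \sum_(y <- l2) y.2)) | x <- l1].
Proof.
move=> + l20; have t2 := total_coef_ge0 _ l20.
set t := \sum_(y <- l2) y.2 in t2 *.
elim: l1 s => [|x l1 IH] s.
  by move=> _ /=; rewrite [X in _ * X]/laplace_value big_ord0 mulr1.
move=> /= /andP[x0 l10]; have t1 := total_coef_ge0 _ l10.
rewrite !laplace_value_cons IH// (laplace_value_shift s x.1 l2)// -/t /=.
rewrite big_cat/= -/t big_map/= -mulr_suml.
rewrite [RHS]mulrACA -powRM; last 2 first.
- lra.
- by rewrite -mulrDl addr_ge0// divr_ge0; lra.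
congr (_ `^ _ * _); field; lra.
Qed.

Let sorted_le l := sort (fun x y : R * R => x.1 <= y.1) l.

Let le_total2 : total (fun x y : R * R => x.1 <= y.1).
Proof. by move=> x y; exact: le_total. Qed.

Let le_trans2 : transitive (fun x y : R * R => x.1 <= y.1).
Proof. by move=> x y z; exact: le_trans. Qed.

Let perm_laplace l l' : perm_eq l l' -> gamma_laplace l = gamma_laplace l'.
Proof.
by move=> ll'; apply: eq_integral => w _; rewrite (perm_big _ ll').
Qed.

(* Tilting by [exp (- U)] multiplies the increments before [t] by
   [(1 + lambda)^-1], where [lambda] is the total coefficient of [U]. *)
Lemma gamma_laplace_tilt (t : R) l1 l2 :
  all (fun x => (0 <= x.1 <= t) && (0 <= x.2)) l1 ->
  all (fun x => (t <= x.1) && (0 <= x.2)) l2 -> 0 <= t ->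
  gamma_laplace (l1 ++ l2) = (gamma_laplace l2 *
    gamma_laplace [seq (x.1, (1 + \sum_(y <- l2) y.2)^-1 * x.2)%R | x <- l1])%E.
Proof.
move=> a1 a2 t0.
(* The closed form needs nondecreasing times. Sorting changes neither functional, and as [t]
   separates the two lists, the sorted lists concatenate into a sorted one. *)
have p1 : perm_eq l1 (sorted_le l1) by rewrite perm_sym perm_sort.
have p2 : perm_eq l2 (sorted_le l2) by rewrite perm_sym perm_sort.
rewrite (perm_laplace (l1 ++ l2) (sorted_le l1 ++ sorted_le l2)); last exact: perm_cat.
rewrite (perm_laplace l2 _ p2) (perm_big _ p2)/=.
rewrite [X in (_ * X)%E](perm_laplace _ [seq (x.1, (1 + \sum_(y <- sorted_le l2) y.2)^-1 * x.2)
   | x <- sorted_le l1]); last exact: perm_map.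
have {}a1 : all (fun x => (0 <= x.1 <= t) && (0 <= x.2)) (sorted_le l1).
  by rewrite -(perm_all _ p1).
have {}a2 : all (fun x => (t <= x.1) && (0 <= x.2)) (sorted_le l2).
  by rewrite -(perm_all _ p2).
have {p1} s1 : sorted (fun x y : R * R => x.1 <= y.1) (sorted_le l1).
  exact: sort_sorted.
have {p2} s2 : sorted (fun x y : R * R => x.1 <= y.1) (sorted_le l2).
  exact: sort_sorted.
move: (sorted_le l1) (sorted_le l2) s1 s2 a1 a2 => {}l1 {}l2 s1 s2 a1 a2.
have c1 : all (fun x => 0 <= x.2) l1 by apply: sub_all a1 => x /andP[].
have c2 : all (fun x => 0 <= x.2) l2 by apply: sub_all a2 => x /andP[].
have tot0 := total_coef_ge0 _ c2.
have u1 : all (fun x => 0 <= x.1) l1 by apply: sub_all a1 => x /andP[/andP[]].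
have u2 : all (fun x => 0 <= x.1) l2.
  by apply: sub_all a2 => x /andP[/(le_trans t0)].
rewrite !laplaceE.
- rewrite laplace_value_cat// EFinM; congr (_ * (laplace_value _ _)%:E)%E.
  by apply: eq_map => x; rewrite mulrC.
- rewrite path_sortedE//; apply/andP; split; first by rewrite all_map.
  rewrite sorted_map; exact: s1.
- rewrite all_map; apply: sub_all c1 => x /= x0.
  by rewrite mulr_ge0// invr_ge0; lra.
- by rewrite path_sortedE// s2 andbT.
- exact: c2.
- rewrite path_sortedE// all_cat u1 u2/=.
  move: s1 s2; rewrite !sorted_pairwise// pairwise_cat => -> ->; rewrite !andbT.
  apply/allrelP => x y /(allP a1) /andP[/andP[_ xt] _] /(allP a2) /andP[ty _].
  exact: le_trans ty.
- by rewrite all_cat c1.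
Qed.

End gamma_laplace.

(** * Independence of the ratios and the future *)

(** [powR] with exponent [-1] is the inverse on nonnegative numbers; passing through [x * x] covers
    negative [x], and at [0] both sides are [0] by convention. *)
Lemma measurable_inv (R : realType) :
  measurable_fun setT (fun x : R => x^-1).
Proof.
have -> : (fun x : R => x^-1) = (fun x : R => x * (x * x) `^ (-1)).
  apply/funext => x; rewrite powR_inv1 -?expr2 ?sqr_ge0//.
  have [->|x0] := eqVneq x 0; first by rewrite invr0 mul0r.
  by rewrite expr2 invfM mulVKf.
apply: measurable_funM => //.
apply: (measurableT_comp (measurable_powR (-1))).
exact: measurable_funM.
Qed.

Lemma measurable_fun_div {d : measure_display} {T : measurableType d}
    {R : realType} (f g : T -> R) :
  measurable_fun setT f -> measurable_fun setT g ->
  measurable_fun setT (fun x => f x / g x).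
Proof.
move=> mf mg; apply: measurable_funM => //.
by apply: (measurableT_comp (measurable_inv R)).
Qed.

Section ratio_independence.
Context {d : measure_display} {T : measurableType d} {R : realType}.
Context (P : probability T R) (g : R -> T -> R) (tau : T -> R).
Hypothesis gp : standard_gamma_process P g.
Hypothesis mtau : measurable_fun setT tau.
Hypothesis tau0 : forall w, 0 < tau w.
Hypothesis itau : indep_sigma P (gen_sigma [set tt] (fun _ : unit => tau))
                                (gen_sigma [set t : R | 0 <= t] g).
Context (t : R) (t0 : 0 <= t).

Definition ratio (s : R) (w : T) := g s w / g t w.

Definition ratio_sets : set (set T) := [set A | exists s, 0 <= s <= t /\
  exists B : set R, measurable B /\ A = ratio s @^-1` B].

(** [None] stands for [tau] and [Some u] for time [u], so that [tau] and the gamma process after [t]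
    form a single nonnegative family to which [laplace_uniqueness] applies. *)
Definition future_index (i : option R) : bool := if i is Some u then t <= u else true.

Definition future (i : option R) : T -> R := if i is Some u then g u else tau.

Definition future_sets : set (set T) := [set A | exists i, future_index i /\
  exists B : set R, measurable B /\ A = future i @^-1` B].

Let mg s : 0 <= s -> measurable_fun setT (g s).
Proof. by case: gp => mg _; exact: mg. Qed.

Let weight (k : R) (l : seq (R * R)) (w : T) :=
  expR (- (k * tau w)) * expR (- \sum_(x <- l) x.2 * g x.1 w).

Let measurable_sum_gamma d' (T' : measurableType d') (f : R -> T' -> R) (l : seq (R * R)) :
  (forall s, 0 <= s -> measurable_fun setT (f s)) ->
  all (fun x => (0 <= x.1) && (0 <= x.2)) l ->
  measurable_fun setT (fun w => expR (- \sum_(x <- l) x.2 * f x.1 w)).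
Proof.
move=> mf okl; apply: measurableT_comp; first exact: measurable_expR.
apply: measurable_funN; elim: l okl => [_|x l IH /= /andP[/andP[x0 _] okl]].
  by under eq_fun do rewrite big_nil; exact: measurable_cst.
under eq_fun do rewrite big_cons; apply: measurable_funD; last exact: IH.
by apply: measurable_funM; [exact: measurable_cst|exact: mf].
Qed.

Let sum_gamma_ge0 (l : seq (R * R)) w : all (fun x => (0 <= x.1) && (0 <= x.2)) l ->
  0 <= \sum_(x <- l) x.2 * g x.1 w.
Proof.
elim: l => [_|x l IH /= /andP[/andP[x0 x1] okl]]; first by rewrite big_nil.
by rewrite big_cons addr_ge0 ?IH// mulr_ge0// (gamma_ge0 _ _ gp).
Qed.

Let weight_tau (k : R) := (\int[P]_w (expR (- (k * tau w)))%:E)%E.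

Let measurable_tau k : measurable_fun setT (fun w => expR (- (k * tau w))).
Proof.
apply: measurableT_comp; first exact: measurable_expR.
by apply: measurable_funN; apply: measurable_funM => //; exact: measurable_cst.
Qed.

Let integral_weight k l : 0 <= k -> all (fun x => (0 <= x.1) && (0 <= x.2)) l ->
  (\int[P]_w (weight k l w)%:E = weight_tau k * gamma_laplace P g l)%E.
Proof.
move=> k0 okl; rewrite indep_integralM//.
- exact: measurable_sum_gamma.
- move=> w; rewrite expR_ge0/= -expR0 ler_expR oppr_le0 mulr_ge0//; exact: ltW.
- apply: (bounded_integrable _ _ 1); first exact: measurable_sum_gamma.
  by move=> w; rewrite ger0_norm ?expR_ge0// -expR0 ler_expR oppr_le0 sum_gamma_ge0.
- move=> A B mA mB; apply: itau.
  + apply: sub_sigma_algebra; exists tt; split=> //.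
    exists ((fun x => expR (- (k * x))) @^-1` A); split=> //.
    rewrite -[X in measurable X]setTI.
    have : measurable_fun setT (fun x => expR (- (k * x))); last exact.
    apply: measurableT_comp; first exact: measurable_expR.
    by apply: measurable_funN; apply: measurable_funM => //; exact: measurable_cst.
  + apply: measurable_g_sigma => //; apply: measurable_sum_gamma => // s s0 _ D mD.
    rewrite setTI; apply: sub_sigma_algebra; exists s; split=> //; exists D; split=> //.
Qed.

Let measurable_weight k l : all (fun x => (0 <= x.1) && (0 <= x.2)) l ->
  measurable_fun setT (weight k l).
Proof. by move=> okl; apply: measurable_funM => //; exact: measurable_sum_gamma. Qed.

Let weight01 k l w : 0 <= k -> all (fun x => (0 <= x.1) && (0 <= x.2)) l ->
  0 <= weight k l w <= 1.
Proof.
move=> k0 okl; rewrite mulr_ge0 ?expR_ge0//= mulr_ile1 ?expR_ge0//.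
  by rewrite -expR0 ler_expR oppr_le0 mulr_ge0//; exact: ltW.
by rewrite -expR0 ler_expR oppr_le0 sum_gamma_ge0.
Qed.

Let okW (l : seq (R * R)) : all (fun x => (t <= x.1) && (0 <= x.2)) l ->
  all (fun x => (0 <= x.1) && (0 <= x.2)) l.
Proof. by apply: sub_all => x /andP[/(le_trans t0) -> ->]. Qed.

Let integral_weight_fin k l : 0 <= k -> all (fun x => (0 <= x.1) && (0 <= x.2)) l ->
  (\int[P]_w (weight k l w)%:E)%E \is a fin_num.
Proof.
move=> k0 okl; apply: integrable_fin_num => //.
apply: (bounded_integrable _ _ 1); first exact: measurable_weight.
by move=> w; have /andP[? ?] := weight01 k l w k0 okl; rewrite ger0_norm.
Qed.

(* Under the tilted law the past of the gamma process is a rescaled gamma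
   process, and ratios do not see the scaling factor. The two laws are realised
   together on [bool * T]. *)
Let ratio_weight k l E : 0 <= k -> all (fun x => (t <= x.1) && (0 <= x.2)) l ->
  <<s ratio_sets >> E -> measurable E /\
  (\int[P]_(w in E) (weight k l w)%:E = P E * \int[P]_w (weight k l w)%:E)%E.
Proof.
move=> k0 okl sE; have okl' := okW _ okl.
set c := (\int[P]_w (weight k l w)%:E)%E.
have cF : c \is a fin_num by exact: integral_weight_fin.
pose lam := 1 + \sum_(x <- l) x.2.
have lamP : 0 < lam.
  rewrite ltr_pwDl//; elim: (l) okl => [_|x l' IH /=].
    by rewrite big_nil.
  by move=> /andP[/andP[_ x0] /IH]; rewrite big_cons; exact: addr_ge0.
have lam0 : lam != 0 by rewrite gt_eqF.
(* The component [true] carries [g], with density [weight k l]; the component [false] carries the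
   rescaled process, with constant density [fine c] so that the total masses match. *)
pose F (s : R) (o : bool * T) := if o.1 then g s o.2 else lam^-1 * g s o.2.
pose J (s : R) := 0 <= s <= t.
pose cyl : set (set (bool * T)) := [set A | exists s, J s /\
  exists B : set R, measurable B /\ A = F s @^-1` B].
(* [F s / F t] equals [ratio s] on both components, the factor [lam^-1] cancelling; hence ratio
   events pulled back by [snd] belong to the sigma-algebra of [F]. *)
have snd_cyl A : <<s ratio_sets >> A -> <<s cyl >> (snd @^-1` A).
  have [S0 SC SU] := smallest_sigma_algebra setT cyl.
  pose H : set (set T) := [set A | <<s cyl >> (snd @^-1` A)].
  move=> sA; apply: (sA H); split.
    split.
    - by rewrite /H /= preimage_set0.
    - by move=> C HC; exact: (SC _ HC).
    - by move=> C HC; rewrite /H /= preimage_bigcup; exact: SU.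
  move=> _ [s [st [B [mB ->]]]].
  have mF r : J r -> @measurable_fun _ _ (g_sigma_algebraType cyl) R setT (F r).
    move=> Jr _ D mD; rewrite setTI; apply: sub_sigma_algebra.
    by exists r; split=> //; exists D.
  have /measurable_g_sigma := measurable_fun_div _ _ (mF s st)
    (mF t (introT andP (conj t0 (lexx t)))).
  move=> /(_ B mB); congr (<<s _ >> _); apply/funext => -[[] w] //=.
  by rewrite /preimage /= /F /= /ratio -mulf_div divff ?invr_eq0// mul1r.
have [||||||||m1 _] := @laplace_uniqueness _ _ _ P (bool * T)%type R
  (fun w => (true, w)) (fun w => (false, w)) J F (weight k l) (cst (fine c))
  (1 + `|fine c|) _ _ _ _ _ _ _ _ (snd @^-1` E) (snd_cyl _ sE).
- by move=> s /andP[s0 _]; exact: mg.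
- move=> s /andP[s0 _]; apply: measurable_funM; first exact: measurable_cst.
  exact: mg.
- move=> s [[] w] /andP[s0 _]; rewrite /F /= ?mulr_ge0 ?invr_ge0 ?(ltW lamP)//.
  + exact: (gamma_ge0 _ _ gp).
  + exact: (gamma_ge0 _ _ gp).
- exact: measurable_weight.
- exact: measurable_cst.
- move=> w; have /andP[? ?] := weight01 k l w k0 okl'.
  by rewrite (ger0_norm (x := weight k l w))//; have := normr_ge0 (fine c); lra.
- by move=> w /=; rewrite lerDr.
- move=> l1 ok1.
  have ok1' : all (fun x => (0 <= x.1) && (0 <= x.2)) l1.
    by apply: sub_all ok1 => x /andP[/andP[-> _] ->].
  have ok2 : all (fun x => (0 <= x.1) && (0 <= x.2)) (l1 ++ l).
    by rewrite all_cat ok1' okl'.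
  have ok3 : all (fun x => (0 <= x.1) && (0 <= x.2))
      [seq (x.1, lam^-1 * x.2) | x <- l1].
    rewrite all_map; apply: sub_all ok1' => x /= /andP[-> x0] /=.
    by apply: mulr_ge0 => //; rewrite invr_ge0 ltW.
  (* The two exponentials merge into the weight of [l1 ++ l]. Independence splits off the factor of
     [tau], the tilting identity splits off that of [l], and together these two factors are [c]. *)
  transitivity (\int[P]_w (weight k (l1 ++ l) w)%:E)%E.
    apply: eq_integral => w _; congr EFin; rewrite /weight big_cat/= opprD expRD.
    by rewrite -mulrA; congr (_ * _); rewrite mulrC.
  rewrite integral_weight// (gamma_laplace_tilt _ _ gp t)// muleA.
  rewrite -integral_weight// -/c.
  rewrite -[in LHS](fineK cF) -integralZl//; last first.
    apply: (bounded_integrable _ _ 1).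
      exact: measurable_sum_gamma.
    by move=> w; rewrite ger0_norm ?expR_ge0// -[leRHS]expR0 ler_expR oppr_le0 sum_gamma_ge0.
  apply: eq_integral => w _; rewrite -EFinM; congr (_ * expR (- _))%:E.
  rewrite big_map; apply: eq_bigr => x _ /=; rewrite /F /=; ring.
- have mE : measurable E := m1.
  have cE : (\int[P]_(w in E) (fine c)%:E = P E * c)%E.
    by rewrite integral_cst// fineK// muleC.
  by move=> h; split=> //; rewrite -cE; exact: h.
Qed.

Let future_split (l : seq (option R * R)) :
  all (fun x => future_index x.1 && (0 <= x.2)) l ->
  exists k l', [/\ 0 <= k, all (fun x => (t <= x.1) && (0 <= x.2)) l' &
   forall w, \sum_(x <- l) x.2 * future x.1 w =
     k * tau w + \sum_(x <- l') x.2 * g x.1 w].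
Proof.
elim: l => [_|[i c] l IH].
  by exists 0, [::]; split=> // w; rewrite !big_nil mul0r addr0.
rewrite [all _ _]/= => /andP[/andP[iu c0] /IH[k [l' [k0 ok' E]]]].
case: i iu => [u|] /= iu.
- exists k, ((u, c) :: l'); split=> //=; first by rewrite iu c0.
  by move=> w; rewrite !big_cons E/= addrCA.
- exists (c + k), l'; split=> //; first exact: addr_ge0.
  by move=> w; rewrite big_cons E/= mulrDl addrA.
Qed.

(** A second use of [laplace_uniqueness], now with the identity map on both sides and densities
    [\1_E] and [P E]: the Laplace identity it asks for is [ratio_weight]. *)
Lemma ratio_future_indep E K : <<s ratio_sets >> E -> <<s future_sets >> K ->
  [/\ measurable E, measurable K & P (E `&` K) = (P E * P K)%E].
Proof.
move=> sE sK; have [mE _] := ratio_weight 0 [::] E (lexx _) isT sE.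
have PE : P E = (fine (P E))%:E by rewrite fineK// fin_num_measure.
have [||||||||mK _] := @laplace_uniqueness _ _ _ P T (option R)
  id id future_index future (\1_E) (cst (fine (P E))) 1 _ _ _ _ _ _ _ _ K sK.
- by move=> [u tu|_] //=; apply: mg; exact: le_trans tu.
- by move=> [u tu|_] //=; apply: mg; exact: le_trans tu.
- move=> [u|] w /=; last by move=> _; exact: ltW.
  by move=> tu; apply: (gamma_ge0 _ _ gp); exact: le_trans tu.
- exact: measurable_indic.
- exact: measurable_cst.
- by move=> w; rewrite indicE; case: (_ \in _); rewrite ?normr1 ?normr0.
- move=> w; rewrite ger0_norm ?fine_ge0//= -lee_fin -PE; exact: probability_le1.
- move=> l /future_split[k [l' [k0 okl' E']]].
  have wE w : expR (- \sum_(x <- l) x.2 * future x.1 w) = weight k l' w.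
    by rewrite E' opprD expRD.
  have [_ h] := ratio_weight k l' E k0 okl' sE.
  transitivity (\int[P]_(w in E) (weight k l' w)%:E)%E.
    rewrite (@integral_indicator _ _ _ _ E _ (fun w => w \in E)); last first.
      by move=> w; split=> [/set_mem|/mem_set].
    by apply: eq_integral => w _; rewrite wE indicE mulrC.
  rewrite h PE -integralZl//; last first.
    apply: (bounded_integrable _ _ 1); first exact/measurable_weight/okW.
    move=> w; have /andP[? ?] := weight01 k l' w k0 (okW _ okl').
    by rewrite ger0_norm.
  by apply: eq_integral => w _; rewrite wE -EFinM.
- have {}mK : measurable K := mK.
  have cK : (\int[P]_(w in K) (fine (P E))%:E = P E * P K)%E.
    by rewrite integral_cst// -PE.
  move=> h; split=> //; rewrite -cK -(integral_indic P mK mE); exact: h.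
Qed.

End ratio_independence.

(** * Sampling at a random time and strict increase of the paths *)

(** [sigma] is approximated by grid points [a n], the successor in [k] keeping them strictly to its
    right because [at_right] is a punctured filter; right-continuity passes to the limit. The
    measurable type is arbitrary, so that the sigma-algebra of the future can be used. *)
Lemma measurable_random_time {d : measure_display} {T : measurableType d}
    {R : realType} (g : R -> T -> R) (t : R) (sigma : T -> R) :
  0 <= t -> (forall u, t <= u -> measurable_fun setT (g u)) ->
  (forall w u, t <= u -> (fun x => g x w) @ at_right u --> g u w) ->
  measurable_fun setT sigma -> (forall w, t <= sigma w) ->
  measurable_fun setT (fun w => g (sigma w) w).
Proof.
move=> t0 mg rg ms ts.
pose k n w := Num.truncn (sigma w * n.+1%:R).
have s0 w : 0 <= sigma w by exact: le_trans (ts w).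
have kP n w : (k n w)%:R <= sigma w * n.+1%:R < (k n w).+1%:R.
  by apply: truncn_itv; rewrite mulr_ge0.
pose a n w : R := (k n w).+1%:R / n.+1%:R.
have ga n w : sigma w < a n w.
  by rewrite /a ltr_pdivlMr//; case/andP: (kP n w).
apply: (@measurable_fun_cvg _ _ _ _ (fun n w => g (a n w) w)).
  move=> n _ B mB; rewrite setTI.
  (* [g u] is measurable only for [t <= u]. The maximum with [t] guards the cells of the grid that
     lie before [t], and changes nothing on the cell that contains [sigma w]. *)
  rewrite (_ : _ @^-1` B = \bigcup_j
    ((fun w => sigma w * n.+1%:R) @^-1` `[j%:R, j.+1%:R[%classic `&`
     g (Num.max t (j.+1%:R / n.+1%:R)) @^-1` B)).
    apply: bigcupT_measurable => j; apply: measurableI.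
      rewrite -[X in measurable X]setTI.
      have : measurable_fun setT (fun w => sigma w * n.+1%:R); last by apply.
      by apply: measurable_funM => //; exact: measurable_cst.
    by rewrite -[X in measurable X]setTI; apply: mg; rewrite // le_max lexx.
  apply/seteqP; split=> w /=.
    move=> Bw; exists (k n w) => //=; split; first by rewrite /= in_itv/= kP.
    by rewrite max_r//; apply: ltW; apply: le_lt_trans (ga n w).
  move=> [j _ /= []]; rewrite in_itv/= => jk.
  have -> : j = k n w.
    by apply/esym/eqP; rewrite truncn_eq// mulr_ge0.
  by rewrite max_r//; apply: ltW; apply: le_lt_trans (ga n w).
move=> w _; move/cvg_at_rightP: (rg w (sigma w) (ts w)); apply.
split=> [n|]; first exact: ga.
apply: (@squeeze_cvgr _ _ _ _ (cst (sigma w)) (fun n => sigma w + n.+1%:R^-1)).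
- apply: nearW => n; rewrite (ltW (ga n w))/=.
  rewrite /a ler_pdivrMr// mulrDl mulVf// -natr1 lerD2r.
  by case/andP: (kP n w).
- exact: cvg_cst.
- rewrite -[X in _ --> X]addr0; apply: cvgD; first exact: cvg_cst.
  exact: cvg_harmonic.
Qed.

Section gamma_increasing.
Context {d : measure_display} {T : measurableType d} {R : realType}.
Context (P : probability T R) (g : R -> T -> R).
Hypothesis gp : standard_gamma_process P g.

Let mg s : 0 <= s -> measurable_fun setT (g s).
Proof. by case: gp => mg _; exact: mg. Qed.

(** On this event the exponential in the Laplace transform is [1], so the probability is at most
    [(1 + lam)] to the power [- (b - a)], which is arbitrarily small; [lam = expR m - 1] turns the
    bound into [expR (- ((b - a) * m))]. *)
Let gamma_eq_null (a b : R) : 0 <= a -> a < b ->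
  measurable [set w | g b w = g a w] /\ P [set w | g b w = g a w] = 0%E.
Proof.
move=> a0 ab; have b0 : 0 <= b by lra.
set E := [set w | g b w = g a w].
have EE : E = (fun w => g b w - g a w) @^-1` [set 0].
  by apply/seteqP; split=> w /=; [move=> ->; rewrite subrr|move=> /eqP; rewrite subr_eq0 => /eqP].
have mE : measurable E.
  rewrite EE -[X in measurable X]setTI.
  have : measurable_fun setT (fun w => g b w - g a w); last by apply.
  by apply: measurable_funB; exact: mg.
split=> //; have [_ [_ [gm [_ [_ [_ glap]]]]]] := gp.
have le m : 0 <= m -> (P E <= (expR (- ((b - a) * m)))%:E)%E.
  move=> m0; have l0 : 0 <= expR m - 1 by rewrite subr_ge0 -expR0 ler_expR.
  have := glap a b (expR m - 1) a0 (ltW ab) l0.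
  rewrite (_ : 1 + (expR m - 1) = expR m); last by ring.
  rewrite /powR gt_eqF ?expR_gt0// expRK mulNr => <-.
  rewrite -[E]setIT -integral_indic//.
  apply: ge0_le_integral => //.
  - by apply/measurable_EFinP; exact: measurable_indic.
  - apply/measurable_EFinP; apply: measurableT_comp; first exact: measurable_expR.
    apply: measurable_funN; apply: measurable_funM; first exact: measurable_cst.
    by apply: measurable_funB; exact: mg.
  - move=> w _; rewrite lee_fin indicE; case: (boolP (w \in E)) => [/set_mem|_].
      by rewrite /E /= => ->; rewrite subrr mulr0 oppr0 expR0.
    exact: expR_ge0.
have PE : P E = (fine (P E))%:E by rewrite fineK// fin_num_measure.
have p0 : 0 <= fine (P E) by rewrite fine_ge0.
apply/eqP; rewrite PE eqe; apply/negPn/negP => pN0.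
have {pN0}p0 : 0 < fine (P E) by rewrite lt_neqAle eq_sym pN0.
move: (fine (P E)) p0 PE le => p p0 -> le.
(* With this [m] the bound reads [p <= expR (- p^-1)], whereas [expR p^-1 >= 1 + p^-1 > p^-1] gives
   the reverse strict inequality. *)
have m0 : 0 <= (p * (b - a))^-1 by rewrite invr_ge0 mulr_ge0//; lra.
have := le _ m0; rewrite lee_fin invfM mulrCA mulfV ?mulr1; last by rewrite gt_eqF//; lra.
apply/negP; rewrite -ltNge expRN -[ltRHS]invrK ltf_pV2 ?posrE ?expR_gt0 ?invr_gt0//.
by have := expR_ge1Dx p^-1; lra.
Qed.

(** [b] will be the random time [tau], so one null set must serve all [b]; by monotonicity the times
    [a + 1/(n+1)] suffice. *)
Lemma gamma_increasing_ae (a : R) : 0 <= a ->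
  exists N : set T, [/\ measurable N, P N = 0%E &
    forall w, ~ N w -> forall b, a < b -> g a w < g b w].
Proof.
move=> a0; exists (\bigcup_n [set w | g (a + n.+1%:R^-1) w = g a w]).
have dP n : a < a + n.+1%:R^-1 by rewrite ltrDl invr_gt0.
have mN n := (gamma_eq_null _ _ a0 (dP n)).1.
split.
- exact: bigcupT_measurable.
- apply/negligibleP; first exact: bigcupT_measurable.
  apply: negligible_bigcup => n; apply/negligibleP => //.
  exact: (gamma_eq_null _ _ a0 (dP n)).2.
- move=> w Nw b ab; have [_ [_ [gm _]]] := gp.
  rewrite lt_neqAle gm ?(ltW ab)// andbT; apply/eqP => gab; apply: Nw.
  have ba : 0 < b - a by lra.
  have [n nP] : exists n, n.+1%:R^-1 < b - a :> R.
    have [n _ /(_ n (leqnn n))] := near_infty_natSinv_lt (PosNum ba).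
    by exists n.
  exists n => //=; apply: le_anti; apply/andP; split.
    by rewrite gab; apply: gm; [exact: le_trans (ltW (dP n))|rewrite -lerBrDl ltW].
  by apply: gm => //; exact: ltW.
Qed.

End gamma_increasing.

(** * Conditioning on a real variable and on independent events *)

(** Radon-Nikodym is applied on [R], to the law of [Z] and the image under [Z] of the measure with
    density [X]. The result is a function [phi] of a real variable, which can later be evaluated at
    [1] and composed with another expression of [zeta t]. *)
Lemma conditional_expectation_rv {d : measure_display} {T : measurableType d}
    {R : realType} (P : probability T R) (Z X : T -> R) :
  measurable_fun setT Z -> P.-integrable setT (EFin \o X) ->
  exists phi : R -> R, [/\ measurable_fun setT phi,
    P.-integrable setT (EFin \o (phi \o Z)) &
    forall B : set R, measurable B ->
      (\int[P]_(w in Z @^-1` B) (phi (Z w))%:E =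
       \int[P]_(w in Z @^-1` B) (X w)%:E)%E].
Proof.
move=> mZ iX.
have mZB B : measurable B -> measurable (Z @^-1` B).
  by move=> mB; rewrite -[X in measurable X]setTI; exact: mZ.
pose Z' : {mfun T >-> R} := HB.pack Z (isMeasurableFun.Build _ _ _ _ Z mZ).
pose mu := distribution P Z'.
pose nu_ : {charge set R -> \bar R} := pushforward (induced_charge iX) Z'.
pose nu := nu_ mZ.
have numu : nu `<< mu.
  apply/null_content_dominatesP => B mB muB.
  rewrite /nu /= /pushforward /induced_charge; apply: null_set_integral => //.
  - exact: mZB.
  - exact/measurable_funTS/(measurable_int P).
pose phi := Radon_Nikodym nu mu.
have iphi : mu.-integrable setT phi by exact: Radon_Nikodym_integrable.
have mphi : measurable_fun setT phi by exact: (measurable_int mu).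
have phiE x : phi x = (fine (phi x))%:E.
  by rewrite fineK//; exact: Radon_Nikodym_fin_num.
have iphiZ : P.-integrable setT (phi \o Z).
  apply/integrableP; split; first exact: measurableT_comp.
  have [_] := integrableP _ _ _ iphi.
  by rewrite ge0_integral_distribution//; exact: measurableT_comp.
exists (fine \o phi); split.
- by apply: measurableT_comp => //; exact: measurable_fine.
- rewrite (_ : _ \o _ = phi \o Z)//; apply/funext => w /=; rewrite -phiE//.
- move=> B mB; transitivity (nu B); last by [].
  rewrite (Radon_Nikodym_integral numu mB) -/phi.
  rewrite integral_pushforward//.
    by apply: eq_integral => w _ /=; rewrite -phiE.
  apply: integrableS iphiZ => //.
  exact: mZB.
Qed.

Lemma integral_setID {d : measure_display} {T : measurableType d}
    {R : realType} (P : probability T R) (f : T -> R) (A D : set T) :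
  measurable A -> measurable D -> P.-integrable setT (EFin \o f) ->
  (\int[P]_(w in A) (f w)%:E =
   \int[P]_(w in A `&` D) (f w)%:E + \int[P]_(w in A `&` ~` D) (f w)%:E)%E.
Proof.
move=> mA mD fi; rewrite -integral_setU//.
- by rewrite -setIUr setUv setIT.
- exact: measurableI.
- by apply: measurableI => //; exact: measurableC.
- exact/measurable_funTS/(measurable_int P).
- by apply/disj_setPS => w [[_ Dw] [_ nDw]].
Qed.

(** This is the product rule for [\1_E] and [W * \1_K]. Integrability is asked on [K] only, since in
    the application [W] is controlled only where it agrees with a variable known to be
    integrable. *)
Lemma indep_sigma_integral {d : measure_display} {T : measurableType d}
    {R : realType} (P : probability T R) (G H : set (set T)) (E K : set T)
    (W : T -> R) :
  (forall A B, <<s G >> A -> <<s H >> B ->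
    [/\ measurable A, measurable B & P (A `&` B) = (P A * P B)%E]) ->
  <<s G >> E -> <<s H >> K ->
  @measurable_fun _ _ (g_sigma_algebraType H) R setT W ->
  P.-integrable K (EFin \o W) ->
  (\int[P]_(w in E `&` K) (W w)%:E = P E * \int[P]_(w in K) (W w)%:E)%E.
Proof.
move=> GH GE HK mW iW; have [mE mK _] := GH _ _ GE HK.
have bE (A : set T) w : (w \in A) <-> A w by split=> [/set_mem|/mem_set].
have mV : @measurable_fun _ _ (g_sigma_algebraType H) R setT (fun w => W w * \1_K w).
  by apply: measurable_funM => //; exact: measurable_indic.
have mU : @measurable_fun _ _ (g_sigma_algebraType G) R setT \1_E.
  exact: measurable_indic.
have sG A : <<s G >> A -> measurable A.
  by move=> sA; have [] := GH _ _ sA HK.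
have sH A : <<s H >> A -> measurable A.
  by move=> sA; have [] := GH _ _ GE sA.
have mV' : measurable_fun setT (fun w => W w * \1_K w).
  by move=> _ B mB; rewrite setTI; apply: sH; exact: measurable_g_sigma.
rewrite [X in (_ * X)%E](@integral_indicator _ _ _ _ _ _ (fun w => w \in K))//.
rewrite (@integral_indicator _ _ _ _ _ _ (fun w => (w \in E) && (w \in K))); last first.
  move=> w; split; first by move=> /andP[/set_mem ? /set_mem].
  by move=> [/mem_set -> /mem_set ->].
have -> : P E = (\int[P]_w (\1_E w)%:E)%E by rewrite integral_indic// setIT.
rewrite -indep_integralM//.
- by apply: eq_integral => w _; rewrite indicE -mulnb natrM mulrCA.
- by move=> w; rewrite indicE; case: (_ \in _); rewrite /= ?lexx ?ler01.
- have -> : EFin \o (fun w => W w * (w \in K)%:R) = (EFin \o W) \_ K.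
    apply/funext => w /=; rewrite patchE; case: (w \in K); rewrite ?mulr1 ?mulr0//.
  by rewrite -(integrable_mkcond _ mK).
- move=> A B mA mB; have sA := measurable_g_sigma _ _ _ mU mA.
  have sB := measurable_g_sigma _ _ _ mV mB.
  by have [_ _] := GH _ _ sA sB.
Qed.

(** * The Markov property *)

Theorem mainTheorem7 (d : measure_display) (T : measurableType d) (R : realType)
  (P : probability T R) (g : R -> T -> R) (tau : T -> R) :
  standard_gamma_process P g ->
  measurable_fun setT tau ->
  (forall w, 0 < tau w) ->
  indep_sigma P (gen_sigma [set tt] (fun _ : unit => tau))
                (gen_sigma [set t : R | 0 <= t] g) ->
  let zeta : R -> T -> R := fun t w => g (Order.min t (tau w)) w / g (tau w) w in
  forall (t h : R) (f : R -> R),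
    0 <= t -> 0 <= h ->
    measurable_fun setT f -> (exists M : R, forall x, `|f x| <= M) ->
    exists Y : T -> R,
      is_cond_exp P (gen_sigma [set s : R | 0 <= s <= t] zeta) (fun w => f (zeta (t + h) w)) Y /\
      is_cond_exp P (gen_sigma [set t] zeta) (fun w => f (zeta (t + h) w)) Y.
Proof.
move=> gp mtau tau0 itau zeta t h f t0 h0 mf [M fM].
have [mg [g0 [gm [rc _]]]] := gp.
have th0 : 0 <= t + h by exact: addr_ge0.
have mzeta s : 0 <= s -> measurable_fun setT (zeta s).
  move=> s0; apply: measurable_fun_div.
  - apply: (measurable_random_time _ 0) => //.
      by apply: measurable_minr => //; exact: measurable_cst.
    by move=> w; rewrite le_min s0 ltW.
  - apply: (measurable_random_time _ 0) => // w; exact: ltW.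
pose X w := f (zeta (t + h) w).
have mX : measurable_fun setT X by apply: measurableT_comp => //; exact: mzeta.
have iX : P.-integrable setT (EFin \o X).
  by apply: (bounded_integrable _ _ M) => // w; exact: fM.
have [phi [mphi iY YX]] := conditional_expectation_rv P (zeta t) X (mzeta t t0) iX.
pose Y := phi \o zeta t; rewrite -/Y in iY.
have mY : measurable_fun setT Y by apply: measurableT_comp => //; exact: mzeta.
pose D := [set w | t < tau w].
have mD : measurable D.
  rewrite (_ : D = tau @^-1` `]t, +oo[%classic); last first.
    by apply/seteqP; split=> w /=; rewrite in_itv/= andbT.
  by rewrite -[X in measurable X]setTI; exact: mtau.
have mDC : measurable (~` D) by exact: measurableC.
have mzB B : measurable B -> measurable (zeta t @^-1` B).
  by move=> mB; rewrite -[X in measurable X]setTI; exact: mzeta.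
(* Outside [N0] the denominator [g (tau w) w] is positive; outside [Nt] the path increases strictly
   right after [t], which keeps [zeta t] away from [1] while [t < tau]. *)
have [N0 [mN0 PN0 gN0]] := gamma_increasing_ae _ _ gp 0 (lexx _).
have [Nt [mNt PNt gNt]] := gamma_increasing_ae _ _ gp t t0.
pose N := N0 `|` Nt.
have mN : measurable N by exact: measurableU.
have PN : P N = 0%E by rewrite null_set_setU.
have gtau w : ~ N w -> 0 < g (tau w) w.
  by move=> Nw; rewrite -(g0 w); apply: gN0 => // Nw'; apply: Nw; left.
have DC1 w : ~ N w -> ~ D w -> zeta t w = 1 /\ zeta (t + h) w = 1.
  move=> Nw /negP; rewrite -leNgt => taut.
  have gw : g (tau w) w != 0 by rewrite gt_eqF// gtau.
  by rewrite /zeta !min_r ?divff// (le_trans taut)// lerDl.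
have D1 w : ~ N w -> zeta t w = 1 -> ~ D w.
  move=> Nw zt Dw; move: zt; rewrite /zeta min_l ?(ltW Dw)//.
  move=> /(congr1 (fun x => x * g (tau w) w)).
  rewrite divfK ?gt_eqF ?gtau// mul1r => e.
  have := gNt w (fun h' => Nw (or_intror h')) _ Dw.
  by rewrite e ltxx.
(* On the complement of [D] both sides are constant, equal to [f 1] and
   [phi 1]; these agree unless that complement is negligible. *)
have partC A : measurable A ->
    (\int[P]_(w in A `&` ~` D) (X w)%:E = \int[P]_(w in A `&` ~` D) (Y w)%:E)%E.
  move=> mA.
  have ae_cst (C : set T) (W : T -> R) (c : R) : measurable C ->
      measurable_fun setT W -> (forall w, ~ N w -> C w -> W w = c) ->
      (\int[P]_(w in C) (W w)%:E = c%:E * P C)%E.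
    move=> mC mW WC; rewrite -integral_cst//; apply: ae_eq_integral => //.
    - by apply/measurable_EFinP; exact: measurable_funTS.
    - exists N; split=> // w /= ncw; apply: contrapT => Nw; apply: ncw => Cw.
      by rewrite WC.
  have [fphi|fphi] := eqVneq (f 1) (phi 1).
    have mADC : measurable (A `&` ~` D) by exact: measurableI.
    rewrite (ae_cst _ X (f 1))// ?(ae_cst _ Y (phi 1)) ?fphi//.
    + by move=> w Nw [_ Dw]; rewrite /Y /= (DC1 w Nw Dw).1.
    + by move=> w Nw [_ Dw]; rewrite /X (DC1 w Nw Dw).2 fphi.
  have m1 : measurable [set 1 : R] by exact: measurable_set1.
  (* Testing on [zeta t = 1], an event of probability [p], gives [phi 1 * p = f 1 * p]. As [f 1] and
     [phi 1] differ, [p = 0], and up to [N] this event contains the complement of [D]. *)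
  have := YX _ m1.
  rewrite (ae_cst (zeta t @^-1` [set 1]) X (f 1))//; first last.
  - by move=> w Nw z1; rewrite /X (DC1 w Nw (D1 w Nw z1)).2.
  - exact: mzB.
  rewrite (ae_cst (zeta t @^-1` [set 1]) Y (phi 1))//; first last.
  - by move=> w Nw z1; rewrite /Y /= z1.
  - exact: mzB.
  move=> e; have P1 : P (zeta t @^-1` [set 1]) = 0%E.
    move: e; rewrite -[P _]fineK ?fin_num_measure//; last exact: mzB.
    rewrite -!EFinM => -[] /eqP; rewrite -subr_eq0 -mulrBl mulf_eq0.
    by rewrite subr_eq0 eq_sym (negbTE fphi) => /eqP ->.
  have PU : P (zeta t @^-1` [set 1] `|` N) = 0%E.
    by rewrite null_set_setU//; exact: mzB.
  have PDC : P (A `&` ~` D) = 0%E.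
    apply: (@subset_measure0 _ _ _ P _ (zeta t @^-1` [set 1] `|` N)) => //.
    + exact: measurableI.
    + by apply: measurableU => //; exact: mzB.
    + move=> w [_ Dw]; have [Nw|Nw] := pselect (N w); first by right.
      by left; exact: (DC1 w Nw Dw).1.
  by rewrite !null_set_integral//; try (exact: measurableI);
    apply/measurable_EFinP; exact: measurable_funTS.
pose RS := ratio_sets g t; pose FS := future_sets g tau t.
have ind E K : <<s RS >> E -> <<s FS >> K ->
    [/\ measurable E, measurable K & P (E `&` K) = (P E * P K)%E].
  exact: ratio_future_indep.
have mFtau : @measurable_fun _ _ (g_sigma_algebraType FS) R setT tau.
  move=> _ B mB; rewrite setTI; apply: sub_sigma_algebra.
  by exists None; split=> //; exists B.
have mFg u : t <= u -> @measurable_fun _ _ (g_sigma_algebraType FS) R setT (g u).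
  move=> tu _ B mB; rewrite setTI; apply: sub_sigma_algebra.
  by exists (Some u); split=> //; exists B.
(* The maxima with [t] make both expressions read [g] only at times from [t] on, everywhere and not
   just on [D]; hence they are measurable for the future. *)
pose zt w := g t w / g (Num.max t (tau w)) w.
pose zth w := g (Num.max t (Num.min (t + h) (tau w))) w / g (Num.max t (tau w)) w.
have ztE w : D w -> zt w = zeta t w.
  by move=> Dw; rewrite /zt /zeta min_l ?max_r// ltW.
have zthE w : D w -> zth w = zeta (t + h) w.
  move=> Dw; rewrite /zth /zeta (@max_r _ _ t (tau w)) ?(ltW Dw)// max_r//.
  by rewrite le_min lerDl h0 ltW.
have mmax : @measurable_fun _ _ (g_sigma_algebraType FS) R setT
    (fun w => g (Num.max t (tau w)) w).
  apply: (measurable_random_time _ t) => //.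
  - by move=> w u tu; apply: rc; exact: le_trans tu.
  - by apply: measurable_maxr => //; exact: measurable_cst.
  - by move=> w; rewrite le_max lexx.
have mzt : @measurable_fun _ _ (g_sigma_algebraType FS) R setT zt.
  by apply: measurable_fun_div => //; exact: mFg.
have mzth : @measurable_fun _ _ (g_sigma_algebraType FS) R setT zth.
  apply: measurable_fun_div => //.
  apply: (measurable_random_time _ t) => //.
  - by move=> w u tu; apply: rc; exact: le_trans tu.
  - apply: measurable_maxr; first exact: measurable_cst.
    by apply: measurable_minr => //; exact: measurable_cst.
  - by move=> w; rewrite le_max lexx.
have FD : <<s FS >> D.
  rewrite (_ : D = tau @^-1` `]t, +oo[%classic); last first.
    by apply/seteqP; split=> w /=; rewrite in_itv/= andbT.
  exact: measurable_g_sigma.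
(* Before [tau] the bridge at time [t] and later is measurable with respect to
   the future, hence independent of the ratios. *)
have factor (W W' : T -> R) E B : P.-integrable setT (EFin \o W) ->
    @measurable_fun _ _ (g_sigma_algebraType FS) R setT W' ->
    (forall w, D w -> W w = W' w) -> <<s RS >> E -> measurable B ->
    (\int[P]_(w in E `&` (zeta t @^-1` B `&` D)) (W w)%:E =
     P E * \int[P]_(w in zeta t @^-1` B `&` D) (W w)%:E)%E.
  move=> iW mW' WE sE mB.
  have KE : zeta t @^-1` B `&` D = zt @^-1` B `&` D.
    by apply/seteqP; split=> w /= [zB Dw]; split=> //; move: zB; rewrite /= ztE.
  have FK : <<s FS >> (zt @^-1` B `&` D).
    have mK : @measurable _ (g_sigma_algebraType FS) (zt @^-1` B).
      exact: measurable_g_sigma.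
    exact: (@measurableI _ (g_sigma_algebraType FS) _ _ mK FD).
  have [_ mK _] := ind _ _ sE FK.
  rewrite KE.
  transitivity (\int[P]_(w in E `&` (zt @^-1` B `&` D)) (W' w)%:E)%E.
    by apply: eq_integral => w /set_mem[_ [_ Dw]]; rewrite WE.
  rewrite (@indep_sigma_integral _ _ _ _ RS FS)//.
    by congr (_ * _)%E; apply: eq_integral => w /set_mem[_ Dw]; rewrite WE.
  apply: (@eq_integrable _ _ _ _ _ mK (EFin \o W)).
    by move=> w /set_mem[_ Dw] /=; rewrite WE.
  exact: integrableS iW.
(* The identity over the whole event minus [partC]; the subtraction is legitimate because the
   removed integral is finite. *)
have partD0 B : measurable B ->
    (\int[P]_(w in zeta t @^-1` B `&` D) (X w)%:E =
     \int[P]_(w in zeta t @^-1` B `&` D) (Y w)%:E)%E.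
  move=> mB; have mZ := mzB _ mB; have e := YX _ mB.
  have eY := integral_setID P Y _ D mZ mD iY.
  have eX := integral_setID P X _ D mZ mD iX.
  have {}e := etrans (etrans (esym eY) e) eX; rewrite partC// in e.
  apply/esym; move: e.
  have yF : (\int[P]_(w in zeta t @^-1` B `&` ~` D) (Y w)%:E)%E \is a fin_num.
    apply: integrable_fin_num; first exact: measurableI.
    by apply: integrableS iY => //; exact: measurableI.
  move: yF; case: (\int[P]_(w in _ `&` ~` D) _)%E => // y _.
  move=> /(congr1 (fun x => x - y%:E)%E); rewrite -!addeA subee// !adde0//.
(* Taking all events of the ratio sigma-algebra makes this a pi-system; on [D], the sigma-algebra it
   generates contains the past of [zeta]. *)
pose G : set (set T) := [set A | exists E B, [/\ <<s RS >> E, measurable B &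
  A = E `&` zeta t @^-1` B]].
have sRST : <<s RS >> setT.
  exact: (@measurableT _ (g_sigma_algebraType RS)).
have GI : setI_closed G.
  move=> _ _ [E1 [B1 [s1 m1 ->]]] [E2 [B2 [s2 m2 ->]]].
  exists (E1 `&` E2), (B1 `&` B2); split.
  - exact: (@measurableI _ (g_sigma_algebraType RS)).
  - exact: measurableI.
  - by rewrite preimage_setI setIACA.
have mul1D (W : T -> R) A : (\int[P]_(w in A `&` D) (W w)%:E =
    \int[P]_(w in A) (W w * \1_D w)%:E)%E.
  have bE w : w \in A <-> A w by split=> [/set_mem|/mem_set].
  rewrite [RHS](@integral_indicator _ _ _ _ _ _ (fun w => w \in A))//.
  rewrite (@integral_indicator _ _ _ _ _ _ (fun w => (w \in A) && (w \in D))).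
    by apply: eq_integral => w _; rewrite indicE -mulnb natrM mulrAC mulrA.
  move=> w; split; first by move=> /andP[/set_mem ? /set_mem].
  by move=> [/mem_set -> /mem_set ->].
have iD (W : T -> R) : P.-integrable setT (EFin \o W) ->
    P.-integrable setT (EFin \o (fun w => W w * \1_D w)).
  move=> iW; have -> : EFin \o (fun w => W w * \1_D w) = (EFin \o W) \_ D.
    apply/funext => w /=; rewrite patchE indicE.
    by case: (w \in D); rewrite ?mulr1 ?mulr0.
  by rewrite -(integrable_mkcond _ mD); exact: integrableS iW.
(* On a set of [G], [factor] pulls [P E] out of both integrals and leaves [partD0]. Placing [\1_D]
   in the integrands spares cutting the sets of [G] by [D]. *)
have partD A : <<s G >> A ->
    (\int[P]_(w in A `&` D) (X w)%:E = \int[P]_(w in A `&` D) (Y w)%:E)%E.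
  move=> sA; have [||||||_ _] := @dynkin_integral_eq _ _ _ P T id id G
    (fun w => X w * \1_D w) (fun w => Y w * \1_D w) GI _ _ _ _ _ A.
  - move=> _ [E [B [sE mB ->]]]; have [mE _ _] := ind _ _ sE FD.
    by split; apply: measurableI => //; exact: mzB.
  - exact: iD.
  - exact: iD.
  - by rewrite -!mul1D; have := partD0 _ measurableT; rewrite preimage_setT.
  - move=> _ [E [B [sE mB ->]]]; rewrite !preimage_id -!mul1D -!setIA.
    rewrite (factor X (f \o zth))//; first last.
    + by move=> w Dw; rewrite /X /= zthE.
    + exact: measurableT_comp.
    rewrite (factor Y (phi \o zt))//; first last.
    + by move=> w Dw; rewrite /Y /= ztE.
    + exact: measurableT_comp.
    by rewrite partD0.
  - exact: sA.
  - by rewrite !preimage_id -!mul1D.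
have mGz : @measurable_fun _ _ (g_sigma_algebraType G) R setT (zeta t).
  move=> _ B mB; rewrite setTI; apply: sub_sigma_algebra.
  by exists setT, B; split=> //; rewrite setTI.
have mGr s : 0 <= s <= t ->
    @measurable_fun _ _ (g_sigma_algebraType G) R setT (ratio g t s).
  move=> st _ B mB; rewrite setTI; apply: sub_sigma_algebra.
  exists (ratio g t s @^-1` B), setT; split=> //.
    by apply: sub_sigma_algebra; exists s; split=> //; exists B.
  by rewrite preimage_setT setIT.
have zetaE s w : 0 <= s <= t -> D w -> zeta s w = ratio g t s w * zeta t w.
  move=> /andP[s0 st] Dw; rewrite /zeta /ratio !min_l ?(ltW Dw)//; last first.
    exact: le_trans (ltW Dw).
  (* When [g t w = 0] the ratio is [0] by the convention on division; monotonicity forces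
     [g s w = 0] as well, so the identity survives. *)
  have [gt0|gt0] := eqVneq (g t w) 0; last by rewrite mulrA divfK.
  suff -> : g s w = 0 by rewrite !mul0r.
  apply: le_anti; apply/andP; split; first by rewrite -gt0; exact: gm.
  exact: (gamma_ge0 _ _ gp).
(* Past events are reached only through their trace on [D]: the measurable sets that agree on [D]
   with a set of [<<s G >>] form a sigma-algebra, which contains the generators by [zetaE]. *)
have trace A : gen_sigma [set s | 0 <= s <= t] zeta A ->
    measurable A /\ exists2 A', <<s G >> A' & A `&` D = A' `&` D.
  pose H : set (set T) := [set A | measurable A /\
    exists2 A', <<s G >> A' & A `&` D = A' `&` D].
  move=> sA; apply: (sA H); split.
    split.
    - split=> //; exists set0 => //.
      exact: (@measurable0 _ (g_sigma_algebraType G)).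
    - move=> C [mC [C' sC' CC']]; split; first by rewrite setTD; exact: measurableC.
      exists (~` C'); first exact: (@measurableC _ (g_sigma_algebraType G)).
      rewrite setTD; apply/seteqP; split=> w [nC Dw]; split=> // Cw; apply: nC.
        by have : (C' `&` D) w by []; rewrite -CC' => -[].
      by have : (C `&` D) w by []; rewrite CC' => -[].
    - move=> C HC; split; first by apply: bigcupT_measurable => n; case: (HC n).
      have /choice[C' C'P] : forall n, exists A', <<s G >> A' /\ C n `&` D = A' `&` D.
        by move=> n; have [_ [A' ? ?]] := HC n; exists A'.
      exists (\bigcup_n C' n).
        apply: (@bigcupT_measurable _ (g_sigma_algebraType G)) => n.
        exact: (C'P n).1.
      rewrite !setI_bigcupl; apply: eq_bigcupr => n _; exact: (C'P n).2.
  move=> _ [s [st [B [mB ->]]]]; split.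
    rewrite -[X in measurable X]setTI; apply: mzeta => //.
    by case/andP: st.
  exists ((fun w => ratio g t s w * zeta t w) @^-1` B).
    apply: measurable_g_sigma => //; apply: measurable_funM => //.
    exact: mGr.
  by apply/seteqP; split=> w /= [Bw Dw]; split=> //; move: Bw; rewrite /= (zetaE s w st Dw).
have YXA A : gen_sigma [set s | 0 <= s <= t] zeta A ->
    (\int[P]_(w in A) (Y w)%:E = \int[P]_(w in A) (X w)%:E)%E.
  move=> /trace[mA [A' sA' AA']].
  rewrite (integral_setID P Y A D mA mD iY).
  rewrite (integral_setID P X A D mA mD iX).
  by rewrite (partC A mA) AA' (partD A' sA').
have tJ : [set s : R | 0 <= s <= t] t by rewrite /= t0 lexx.
have sYt B : measurable B -> gen_sigma [set t] zeta (Y @^-1` B).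
  move=> mB; apply: sub_sigma_algebra; exists t; split=> //.
  exists (phi @^-1` B); split=> //.
  by rewrite -[X in measurable X]setTI; exact: mphi.
have sub A : gen_sigma [set t] zeta A -> gen_sigma [set s | 0 <= s <= t] zeta A.
  apply: sub_sigma_algebra2 => _ [s [-> [B [mB ->]]]].
  by exists t; split=> //; exists B.
exists Y; split; split=> //.
- by move=> B mB; apply: sub; exact: sYt.
- by move=> A sA; apply: YXA; exact: sub.
Qed.
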